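(* Let $|q|<1$, and let $w,y$ be nonzero complex numbers with $w\notin\{q^m:m\in\mathbb Z\}$ and such that no denominator below vanishes. Define $G_5^{*}(w,y,q)=\sum_{n=-\infty}^{\infty}\frac{w^nq^{n^2}}{(y;q)_n}$. Then \begin{align*} G_5^{*}(w,y,q)&=\frac{(y/w;q)_{\infty}}{(y;q)_{\infty}}\sum_{r=-\infty}^{\infty}(wq/y;q)_r(-y)^rq^{r(r-1)/2}\\ &=\frac{(y/w;q)_{\infty}}{(wq,q/w;q)_{\infty}}\sum_{r=-\infty}^{\infty}\frac{(1-wq^{2r})(wq/y;q)_r(-yw^2)^rq^{(5r^2-3r)/2}}{(1-w)(y;q)_r}. \end{align*}
   Context: For $n\ge 0$, $(a;q)_n=\prod_{j=0}^{n-1}(1-aq^j)$, $(a;q)_\infty=\prod_{j\ge0}(1-aq^j)$, and for negative index $(a;q)_{-n}=1/(aq^{-n};q)_n$. Also $(a_1,\dots,a_k;q)_n=(a_1;q)_n\cdots(a_k;q)_n$ (same for $n=\infty$). *)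

(* Defs.v *)
From Stdlib Require Import Reals ZArith ClassicalEpsilon.
Open Scope R_scope.

Definition Cplx : Type := (R * R)%type.
Definition Cof (x : R) : Cplx := (x, 0).
Definition C0 : Cplx := (0, 0).
Definition C1 : Cplx := (1, 0).
Definition Cadd (z u : Cplx) : Cplx := (fst z + fst u, snd z + snd u).
Definition Copp (z : Cplx) : Cplx := (- fst z, - snd z).
Definition Csub (z u : Cplx) : Cplx := Cadd z (Copp u).
Definition Cmul (z u : Cplx) : Cplx :=
  (fst z * fst u - snd z * snd u, fst z * snd u + snd z * fst u).
(* Cinv 0 = 0 (junk value, never used under the hypotheses). *)
Definition Cinv (z : Cplx) : Cplx :=
  let d := fst z * fst z + snd z * snd z in (fst z / d, - snd z / d).
Definition Cdiv (z u : Cplx) : Cplx := Cmul z (Cinv u).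
Definition Cnorm (z : Cplx) : R := sqrt (fst z * fst z + snd z * snd z).

Fixpoint Cpow (z : Cplx) (n : nat) : Cplx :=
  match n with O => C1 | S m => Cmul z (Cpow z m) end.

Definition Czpow (z : Cplx) (n : Z) : Cplx :=
  match n with
  | Z0 => C1
  | Zpos p => Cpow z (Pos.to_nat p)
  | Zneg p => Cinv (Cpow z (Pos.to_nat p))
  end.

Definition Ccv (u : nat -> Cplx) (l : Cplx) : Prop :=
  forall eps : R, eps > 0 -> exists N : nat, forall n : nat, (n >= N)%nat ->
    Cnorm (Csub (u n) l) < eps.

Definition Clim (u : nat -> Cplx) : Cplx :=
  epsilon (inhabits C0) (fun l => Ccv u l).

Fixpoint Csum (f : nat -> Cplx) (n : nat) : Cplx :=
  match n with O => f O | S m => Cadd (Csum f m) (f (S m)) end.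

Definition bicv (f : Z -> Cplx) (l : Cplx) : Prop :=
  exists a b : Cplx,
    Ccv (Csum (fun n => f (Z.of_nat n))) a /\
    Ccv (Csum (fun n => f (- Z.of_nat (S n))%Z)) b /\
    l = Cadd a b.

Fixpoint qpoch (a q : Cplx) (n : nat) : Cplx :=
  match n with
  | O => C1
  | S m => Cmul (qpoch a q m) (Csub C1 (Cmul a (Cpow q m)))
  end.

Definition qpochZ (a q : Cplx) (n : Z) : Cplx :=
  match n with
  | Zneg p => Cinv (qpoch (Cmul a (Czpow q n)) q (Pos.to_nat p))
  | _ => qpoch a q (Z.to_nat n)
  end.

Definition qpinf (a q : Cplx) : Cplx := Clim (qpoch a q).

Definition G5term (w y q : Cplx) (n : Z) : Cplx :=
  Cdiv (Cmul (Czpow w n) (Czpow q (n * n)%Z)) (qpochZ y q n).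

Definition rhs1term (w y q : Cplx) (r : Z) : Cplx :=
  Cmul (Cmul (qpochZ (Cdiv (Cmul w q) y) q r) (Czpow (Copp y) r))
       (Czpow q ((r * (r - 1)) / 2)%Z).

Definition rhs2term (w y q : Cplx) (r : Z) : Cplx :=
  Cdiv
    (Cmul (Cmul (Cmul (Csub C1 (Cmul w (Czpow q (2 * r)%Z)))
                      (qpochZ (Cdiv (Cmul w q) y) q r))
                (Czpow (Copp (Cmul y (Cmul w w))) r))
          (Czpow q ((5 * r * r - 3 * r) / 2)%Z))
    (Cmul (Csub C1 w) (qpochZ y q r)).

(* Main.v *)
(* Multiplied by (y;q)_oo, and with infinite products in shifted arguments in place of the finite ones, the
   three sides become, with theta(w) = (w, q/w; q)_oo,
     F(w,y) = sum_r w^r q^(r^2) (y q^r)_oo,     H(w,y) = sum_r w^r q^(r^2) (y q^(-r) / w)_oo,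
     P(w,y) / theta(w),  P(w,y) = sum_r (1 - w q^(2r)) w^(3r) q^(3r^2-r) (y q^r)_oo (y q^(-r) / w)_oo.
   All three satisfy
     f(w,y) - f(w,qy) = - y f(wq,qy)   and   f(w,y) = wq f(wq^2,qy).
   These relations determine f(w,y) from the limits of f(w,y q^N) and f(wq,y q^N), which do not depend
   on y.  F and H visibly have the same limit.  For F and P / theta the limit may be computed along
   y = q^N; there both relations reduce the claim to y = q, where they give the Rogers-Ramanujan
   recurrence f(w) = f(wq) + wq f(wq^2).  At y = q the terms with r < 0 vanish, so both sides tend
   to (q)_oo as w runs through w q^N, and the recurrence forces equality.  This avoids the quintuple
   product identity, which is the case y = 0. *)

From Stdlib Require Import Reals ZArith Lra Lia ClassicalEpsilon.
From Coquelicot Require Complex.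
Require Import Defs.
Open Scope R_scope.

(* The two relations give a linear system for the pair f(w, y q^n), f(wq, y q^n) that is the
   identity up to terms of size |q|^n. The product of the factors 1 + C |q|^n converges, so a
   solution tending to 0 is 0 from the start; in this sense the limits determine f.

   P is compared with F through [theta w * Fsum w y - Psum w y], not through a quotient: the
   relations then hold at every nonzero w, zeros of theta included.

   Convergence, and every exchange of a limit with a sum over r, comes down to counting the
   coefficient of r^2 ln|q| in the exponent. A factor q^(r^2) counts 1, a shifted infinite product
   at worst -1/2, on the side where it acquires |r| large factors. This leaves 1/2 for F and H and 3
   - 1/2 - 1/2 = 2 for P.

   The delicate limit is w q^N -> 0 in P at y = q, because (q/w)_oo is unbounded there. Being a
   factor of theta, it is pulled out of every term first. What remains of that product is a finite
   reversed one, estimated crudely with coefficient -1, so the count is still 3 - 1 - 1/2 = 3/2. *)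
Declare Scope cplx_scope.
Delimit Scope cplx_scope with X.
Bind Scope cplx_scope with Cplx.
Infix "+" := Cadd : cplx_scope.
Infix "-" := Csub : cplx_scope.
Infix "*" := Cmul : cplx_scope.
Infix "/" := Cdiv : cplx_scope.
Notation "- z" := (Copp z) : cplx_scope.
Notation "0" := C0 : cplx_scope.
Notation "1" := C1 : cplx_scope.
Arguments Cpow z%_X n%_nat.
Arguments Czpow z%_X n%_Z.
Arguments Cnorm z%_X.
Arguments Cinv z%_X.

(** * The field of complex numbers and its norm *)

Lemma Cplx_field_theory :
  field_theory C0 C1 Cadd Cmul Csub Copp Cdiv Cinv (@eq Cplx).
Proof.
  split.
  - split; intros; repeat match goal with z : Cplx |- _ => destruct z end;
      unfold Csub, Cadd, Cmul, Copp, C0, C1; simpl; f_equal; ring.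
  - intro H. injection H. intros. lra.
  - reflexivity.
  - intros [a b] H. unfold Cmul, Cinv, C1; simpl.
    assert (a * a + b * b <> 0).
    { intro E. apply H. unfold C0. f_equal; nra. }
    f_equal; field; assumption.
Qed.
Add Field Cplx_field : Cplx_field_theory.

Lemma Cnorm_Cmod (z : Cplx) : Cnorm z = Complex.Cmod z.
Proof. unfold Cnorm, Complex.Cmod. f_equal. ring. Qed.
Lemma Cnorm_add (z u : Cplx) : Cnorm (z + u) <= Cnorm z + Cnorm u.
Proof. rewrite !Cnorm_Cmod. apply Complex.Cmod_triangle. Qed.
Lemma Cnorm_mul (z u : Cplx) : Cnorm (z * u) = Cnorm z * Cnorm u.
Proof. rewrite !Cnorm_Cmod. apply Complex.Cmod_mult. Qed.
Lemma Cnorm_ge0 (z : Cplx) : 0 <= Cnorm z.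
Proof. apply sqrt_pos. Qed.
Lemma Cnorm_0 : Cnorm 0 = 0.
Proof. rewrite Cnorm_Cmod. apply Complex.Cmod_0. Qed.
Lemma Cnorm_1 : Cnorm 1 = 1.
Proof. rewrite Cnorm_Cmod. apply Complex.Cmod_1. Qed.
Lemma Cnorm_eq0 (z : Cplx) : Cnorm z = 0 -> z = C0.
Proof. rewrite Cnorm_Cmod. apply Complex.Cmod_eq_0. Qed.
Lemma Cnorm_gt0 (z : Cplx) : z <> C0 -> 0 < Cnorm z.
Proof. intro H. rewrite Cnorm_Cmod. now apply Complex.Cmod_gt_0. Qed.
Lemma Cnorm_opp (z : Cplx) : Cnorm (- z) = Cnorm z.
Proof. rewrite !Cnorm_Cmod. apply Complex.Cmod_opp. Qed.
Lemma Cnorm_sub (z u : Cplx) : Cnorm (z - u) <= Cnorm z + Cnorm u.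
Proof. unfold Csub. rewrite <- (Cnorm_opp u). apply Cnorm_add. Qed.
Lemma Cnorm_sub_sym (z u : Cplx) : Cnorm (z - u) = Cnorm (u - z).
Proof. rewrite <- Cnorm_opp. f_equal. ring. Qed.
Lemma Cnorm_inv (z : Cplx) : z <> C0 -> Cnorm (Cinv z) = / Cnorm z.
Proof.
  intro H. pose proof (Cnorm_gt0 z H).
  apply Rmult_eq_reg_l with (Cnorm z); [|lra].
  rewrite <- Cnorm_mul, Rinv_r by lra.
  replace (z * Cinv z)%X with C1 by (field; exact H). apply Cnorm_1.
Qed.
Lemma Cnorm_pow (z : Cplx) (n : nat) : Cnorm (Cpow z n) = Cnorm z ^ n.
Proof.
  induction n as [|n IH]; simpl; [apply Cnorm_1|]. now rewrite Cnorm_mul, IH.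
Qed.
Lemma Rabs_fst_le_Cnorm (z : Cplx) : Rabs (fst z) <= Cnorm z.
Proof.
  destruct z as [a b]. unfold Cnorm; simpl. rewrite <- sqrt_Rsqr_abs.
  apply sqrt_le_1_alt. unfold Rsqr. nra.
Qed.
Lemma Rabs_snd_le_Cnorm (z : Cplx) : Rabs (snd z) <= Cnorm z.
Proof.
  destruct z as [a b]. unfold Cnorm; simpl. rewrite <- sqrt_Rsqr_abs.
  apply sqrt_le_1_alt. unfold Rsqr. nra.
Qed.
Lemma Cnorm_le_abs (z : Cplx) : Cnorm z <= Rabs (fst z) + Rabs (snd z).
Proof.
  replace z with (Cadd (fst z, 0%R) (0%R, snd z)) at 1
    by (destruct z; unfold Cadd; simpl; f_equal; ring).
  eapply Rle_trans; [apply Cnorm_add|].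
  unfold Cnorm; simpl. rewrite <- !sqrt_Rsqr_abs. unfold Rsqr.
  apply Req_le. f_equal; f_equal; ring.
Qed.

Lemma Cmul_integral (z u : Cplx) : (z * u)%X = C0 -> z = C0 \/ u = C0.
Proof.
  intro H. destruct (excluded_middle_informative (z = C0)) as [|Hz]; [now left|right].
  replace u with (z * u / z)%X by (field; exact Hz). rewrite H. field. exact Hz.
Qed.
Lemma Cmul_neq0 (z u : Cplx) : z <> C0 -> u <> C0 -> (z * u)%X <> C0.
Proof. intros Hz Hu H. destruct (Cmul_integral _ _ H); auto. Qed.
Lemma Cinv_neq0 (z : Cplx) : z <> C0 -> Cinv z <> C0.
Proof.
  intros Hz H. apply (F_1_neq_0 Cplx_field_theory).
  replace C1 with (z * Cinv z)%X by (field; exact Hz). rewrite H. ring.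
Qed.
Lemma Cdiv_neq0 (z u : Cplx) : z <> C0 -> u <> C0 -> (z / u)%X <> C0.
Proof. intros. apply Cmul_neq0; auto using Cinv_neq0. Qed.
Lemma Copp_neq0 (z : Cplx) : z <> C0 -> (- z)%X <> C0.
Proof. intros H E. apply H. replace z with (- - z)%X by ring. rewrite E. ring. Qed.
Lemma Csub_neq0 (z u : Cplx) : z <> u -> (z - u)%X <> C0.
Proof. intros H E. apply H. replace z with (z - u + u)%X by ring. rewrite E. ring. Qed.

(** * Limits *)

Lemma Ccv_unique u l m : Ccv u l -> Ccv u m -> l = m.
Proof.
  intros Hl Hm.
  replace l with (l - m + m)%X by ring.
  enough (E : (l - m)%X = C0) by (rewrite E; ring).
  apply Cnorm_eq0. apply Rle_antisym; [|apply Cnorm_ge0].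
  apply le_epsilon. intros e He.
  destruct (Hl (e / 2)) as [N HN]; [lra|]. destruct (Hm (e / 2)) as [M HM]; [lra|].
  specialize (HN (max N M) (Nat.le_max_l _ _)). specialize (HM (max N M) (Nat.le_max_r _ _)).
  rewrite Cnorm_sub_sym in HN.
  replace (l - m)%X with (l - u (max N M) + (u (max N M) - m))%X by ring.
  pose proof (Cnorm_add (l - u (max N M)) (u (max N M) - m)). lra.
Qed.
Lemma Ccv_ext u v l : (forall n, u n = v n) -> Ccv u l -> Ccv v l.
Proof. intros H Hu e He. destruct (Hu e He) as [N HN]. exists N. intros. rewrite <- H. auto. Qed.
Lemma Ccv_const z : Ccv (fun _ => z) z.
Proof.
  intros e He. exists O. intros. replace (z - z)%X with C0 by ring. rewrite Cnorm_0. lra.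
Qed.
Lemma Ccv_add u v l m : Ccv u l -> Ccv v m -> Ccv (fun n => u n + v n)%X (l + m)%X.
Proof.
  intros Hl Hm e He.
  destruct (Hl (e / 2)) as [N HN]; [lra|]. destruct (Hm (e / 2)) as [M HM]; [lra|].
  exists (max N M). intros n Hn. specialize (HN n ltac:(lia)). specialize (HM n ltac:(lia)).
  replace (u n + v n - (l + m))%X with ((u n - l) + (v n - m))%X by ring.
  eapply Rle_lt_trans; [apply Cnorm_add|]. lra.
Qed.
Lemma Ccv_scal c u l : Ccv u l -> Ccv (fun n => c * u n)%X (c * l)%X.
Proof.
  intros Hl e He. pose proof (Cnorm_ge0 c).
  destruct (Hl (e / (Cnorm c + 1))) as [N HN]; [apply Rdiv_lt_0_compat; lra|].
  exists N. intros n Hn. specialize (HN n Hn).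
  replace (c * u n - c * l)%X with (c * (u n - l))%X by ring. rewrite Cnorm_mul.
  apply Rle_lt_trans with ((Cnorm c) * (e / (Cnorm c + 1))).
  - apply Rmult_le_compat_l; lra.
  - apply Rlt_le_trans with ((Cnorm c + 1) * (e / (Cnorm c + 1))).
    + apply Rmult_lt_compat_r; [apply Rdiv_lt_0_compat; lra|lra].
    + right. field. lra.
Qed.
Lemma Ccv_opp u l : Ccv u l -> Ccv (fun n => - u n)%X (- l)%X.
Proof.
  intro H. replace (- l)%X with (- (1) * l)%X by ring.
  apply Ccv_ext with (fun n => - (1) * u n)%X; [intro; ring|]. now apply Ccv_scal.
Qed.
Lemma Ccv_sub u v l m : Ccv u l -> Ccv v m -> Ccv (fun n => u n - v n)%X (l - m)%X.
Proof. intros. unfold Csub. apply Ccv_add; auto using Ccv_opp. Qed.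
Lemma Ccv_bounded u l : Ccv u l -> exists B, 0 <= B /\ forall n, Cnorm (u n) <= B.
Proof.
  intro H. destruct (H 1) as [N HN]; [lra|].
  assert (HB : forall M, exists B, 0 <= B /\ forall n, (n < M)%nat -> Cnorm (u n) <= B).
  { induction M as [|M [B [HB0 HB]]]; [exists 0; split; [lra|intros; lia]|].
    exists (B + Cnorm (u M)). pose proof (Cnorm_ge0 (u M)). split; [lra|]. intros n Hn.
    destruct (Nat.eq_dec n M) as [->|]; [lra|]. specialize (HB n ltac:(lia)). lra. }
  destruct (HB N) as [B [HB0 HB']]. exists (B + (Cnorm l + 1)).
  pose proof (Cnorm_ge0 l). split; [lra|]. intro n.
  destruct (Nat.lt_ge_cases n N) as [Hn|Hn].
  - specialize (HB' n Hn). lra.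
  - specialize (HN n Hn). pose proof (Cnorm_add (u n - l) l) as T.
    replace (u n - l + l)%X with (u n) in T by ring. lra.
Qed.
Lemma Ccv0_mul_bounded u v B : (forall n, Cnorm (v n) <= B) -> Ccv u C0 -> Ccv (fun n => v n * u n)%X C0.
Proof.
  intros HB Hu e He. pose proof (Rle_trans _ _ _ (Cnorm_ge0 _) (HB O)).
  destruct (Hu (e / (B + 1))) as [N HN]; [apply Rdiv_lt_0_compat; lra|].
  exists N. intros n Hn. specialize (HN n Hn).
  replace (v n * u n - 0)%X with (v n * (u n - 0))%X by ring. rewrite Cnorm_mul.
  apply Rle_lt_trans with (B * (e / (B + 1))).
  - apply Rmult_le_compat; auto using Cnorm_ge0. lra.
  - apply Rlt_le_trans with ((B + 1) * (e / (B + 1))).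
    + apply Rmult_lt_compat_r; [apply Rdiv_lt_0_compat; lra|lra].
    + right. field. lra.
Qed.
Lemma Ccv_mul u v l m : Ccv u l -> Ccv v m -> Ccv (fun n => u n * v n)%X (l * m)%X.
Proof.
  intros Hl Hm. destruct (Ccv_bounded _ _ Hm) as [B [_ HB]].
  replace (l * m)%X with (0 + l * m)%X by ring.
  apply Ccv_ext with (fun n => v n * (u n - l) + l * v n)%X; [intro; ring|].
  apply Ccv_add; [|now apply Ccv_scal].
  apply Ccv0_mul_bounded with B; auto.
  replace C0 with (l - l)%X by ring. apply Ccv_sub; auto using Ccv_const.
Qed.
Lemma Ccv_inv u l : l <> C0 -> Ccv u l -> Ccv (fun n => Cinv (u n)) (Cinv l).
Proof.
  intros Hl0 Hl. pose proof (Cnorm_gt0 l Hl0) as Hp. intros e He.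
  set (d := Rmin (Cnorm l / 2) (e * (Cnorm l * Cnorm l / 2))).
  destruct (Hl d) as [N HN].
  { apply Rmin_glb_lt; [lra|]. assert (0 < Cnorm l * Cnorm l) by nra. nra. }
  exists N. intros n Hn. specialize (HN n Hn).
  assert (H1 : Cnorm (u n - l) < Cnorm l / 2) by (eapply Rlt_le_trans; [exact HN|apply Rmin_l]).
  assert (H2 : Cnorm (u n - l) < e * (Cnorm l * Cnorm l / 2)) by (eapply Rlt_le_trans; [exact HN|apply Rmin_r]).
  pose proof (Cnorm_sub (u n) (u n - l)) as T.
  replace (u n - (u n - l))%X with l in T by ring.
  assert (Hu : Cnorm l / 2 < Cnorm (u n)) by lra.
  assert (Hu0 : u n <> C0) by (intro E; rewrite E, Cnorm_0 in Hu; lra).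
  replace (Cinv (u n) - Cinv l)%X with (Cinv (u n) * Cinv l * (l - u n))%X by (field; auto).
  rewrite !Cnorm_mul, !Cnorm_inv, (Cnorm_sub_sym l) by auto.
  apply Rmult_lt_reg_l with (Cnorm (u n) * Cnorm l); [nra|].
  replace (Cnorm (u n) * Cnorm l * (/ Cnorm (u n) * / Cnorm l * Cnorm (u n - l))) with (Cnorm (u n - l)) by (field; lra).
  assert (Cnorm l * Cnorm l / 2 <= Cnorm (u n) * Cnorm l) by nra. nra.
Qed.
Lemma Ccv_shift u l k : Ccv u l -> Ccv (fun n => u (n + k)%nat) l.
Proof. intros H e He. destruct (H e He) as [N HN]. exists N. intros. apply HN. lia. Qed.
Lemma Ccv_unshift u l : Ccv (fun n => u (S n)) l -> Ccv u l.
Proof.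
  intros H e He. destruct (H e He) as [N HN]. exists (S N). intros [|n] Hn; [lia|]. apply HN. lia.
Qed.
Lemma Ccv_norm_le u l B : (forall n, Cnorm (u n) <= B) -> Ccv u l -> Cnorm l <= B.
Proof.
  intros HB H. apply le_epsilon. intros e He. destruct (H e He) as [N HN].
  specialize (HN N (le_n _)). specialize (HB N).
  pose proof (Cnorm_sub (u N) (u N - l)) as T.
  replace (u N - (u N - l))%X with l in T by ring. lra.
Qed.
Lemma Ccv_Clim u l : Ccv u l -> Ccv u (Clim u).
Proof. intro H. unfold Clim. apply epsilon_spec. now exists l. Qed.

Lemma Cauchy_Ccv u :
  (forall eps, eps > 0 -> exists N, forall n m, (n >= N)%nat -> (m >= N)%nat -> Cnorm (u n - u m) < eps) ->
  exists l, Ccv u l.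
Proof.
  intro H.
  destruct (R_complete (fun n => fst (u n))) as [a Ha].
  { intros e He. destruct (H e He) as [N HN]. exists N. intros n m Hn Hm.
    eapply Rle_lt_trans; [|exact (HN n m Hn Hm)].
    apply (Rabs_fst_le_Cnorm (u n - u m)). }
  destruct (R_complete (fun n => snd (u n))) as [b Hb].
  { intros e He. destruct (H e He) as [N HN]. exists N. intros n m Hn Hm.
    eapply Rle_lt_trans; [|exact (HN n m Hn Hm)].
    apply (Rabs_snd_le_Cnorm (u n - u m)). }
  exists (a, b). intros e He.
  destruct (Ha (e / 2)) as [N HN]; [lra|]. destruct (Hb (e / 2)) as [M HM]; [lra|].
  exists (max N M). intros n Hn. specialize (HN n ltac:(lia)). specialize (HM n ltac:(lia)).
  eapply Rle_lt_trans; [apply Cnorm_le_abs|]. unfold Rdist in *.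
  unfold Csub, Cadd, Copp; simpl. unfold Rminus in *. lra.
Qed.

Lemma geometric_increments_Ccv u K r : 0 <= r < 1 -> (forall n, Cnorm (u (S n) - u n) <= K * r ^ n) ->
  exists l, Ccv u l.
Proof.
  intros Hr Hu.
  assert (HK : 0 <= K).
  { specialize (Hu O). simpl in Hu. pose proof (Cnorm_ge0 (u 1%nat - u O)). lra. }
  assert (Hinc : forall n k, Cnorm (u (n + k)%nat - u n) <= K / (1 - r) * r ^ n).
  { intros n k.
    assert (Cnorm (u (n + k)%nat - u n) <= K / (1 - r) * (r ^ n - r ^ (n + k))).
    { induction k as [|k IH].
      - rewrite Nat.add_0_r. replace (u n - u n)%X with C0 by ring. rewrite Cnorm_0. lra.
      - replace (n + S k)%nat with (S (n + k)) by lia.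
        replace (u (S (n + k)) - u n)%X with ((u (S (n + k)) - u (n + k)%nat) + (u (n + k)%nat - u n))%X by ring.
        eapply Rle_trans; [apply Cnorm_add|]. specialize (Hu (n + k)%nat). simpl pow.
        replace (K / (1 - r) * (r ^ n - r * r ^ (n + k))) with (K / (1 - r) * (r ^ n - r ^ (n + k)) + K * r ^ (n + k)) by (field; lra).
        lra. }
    eapply Rle_trans; [exact H|]. apply Rmult_le_compat_l.
    - apply Rle_mult_inv_pos; lra.
    - pose proof (pow_le r (n + k) (proj1 Hr)). lra. }
  apply Cauchy_Ccv. intros e He.
  destruct (pow_lt_1_zero r ltac:(rewrite Rabs_pos_eq; lra) (e / (2 * (K / (1 - r) + 1)))) as [N HN].
  { assert (0 <= K / (1 - r)) by (apply Rle_mult_inv_pos; lra). apply Rdiv_lt_0_compat; lra. }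
  assert (Hk : forall k, Cnorm (u (N + k)%nat - u N) < e / 2).
  { intro k. eapply Rle_lt_trans; [apply Hinc|]. specialize (HN N (le_n _)).
    rewrite Rabs_pos_eq in HN by (apply pow_le; lra).
    assert (0 <= K / (1 - r)) by (apply Rle_mult_inv_pos; lra).
    apply Rle_lt_trans with ((K / (1 - r)) * (e / (2 * (K / (1 - r) + 1)))).
    - apply Rmult_le_compat_l; lra.
    - apply Rlt_le_trans with ((K / (1 - r) + 1) * (e / (2 * (K / (1 - r) + 1)))).
      + apply Rmult_lt_compat_r; [apply Rdiv_lt_0_compat; lra|lra].
      + right. field. split; lra. }
  exists N. intros n m Hn Hm.
  pose proof (Hk (n - N)%nat) as H1. pose proof (Hk (m - N)%nat) as H2.
  replace (N + (n - N))%nat with n in H1 by lia. replace (N + (m - N))%nat with m in H2 by lia.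
  rewrite Cnorm_sub_sym in H2.
  replace (u n - u m)%X with ((u n - u N) + (u N - u m))%X by ring.
  pose proof (Cnorm_add (u n - u N) (u N - u m)). lra.
Qed.
Lemma Ccv_geometric u l K r : 0 <= r < 1 -> (forall n, Cnorm (u n - l) <= K * r ^ n) -> Ccv u l.
Proof.
  intros Hr Hu e He.
  assert (HK : 0 <= K).
  { specialize (Hu O). simpl in Hu. pose proof (Cnorm_ge0 (u O - l)). lra. }
  destruct (pow_lt_1_zero r ltac:(rewrite Rabs_pos_eq; lra) (e / (K + 1))) as [N HN].
  { apply Rdiv_lt_0_compat; lra. }
  exists N. intros n Hn. specialize (HN n Hn). rewrite Rabs_pos_eq in HN by (apply pow_le; lra).
  eapply Rle_lt_trans; [apply Hu|].
  apply Rle_lt_trans with (K * (e / (K + 1))).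
  - apply Rmult_le_compat_l; lra.
  - apply Rlt_le_trans with ((K + 1) * (e / (K + 1))).
    + apply Rmult_lt_compat_r; [apply Rdiv_lt_0_compat; lra|lra].
    + right. field. lra.
Qed.

(** * Integer powers *)

Lemma Z_sign_cases (n : Z) : exists m : nat, n = Z.of_nat m \/ n = (- Z.of_nat (S m))%Z.
Proof.
  destruct (Z_le_dec 0 n).
  - exists (Z.to_nat n). left. lia.
  - exists (Z.to_nat (- n - 1)). right. lia.
Qed.
(** An equivalence as the step serves both directions at once. It suits power laws, where passing
    from n to n + 1 multiplies by something invertible. *)
Lemma Z_step_ind (P : Z -> Prop) :
  P 0%Z -> (forall n, P n <-> P (n + 1)%Z) -> forall n, P n.
Proof.
  intros H0 HS n. destruct (Z_sign_cases n) as [m [-> | ->]].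
  - induction m as [|m IH]; [exact H0|].
    rewrite Nat2Z.inj_succ. unfold Z.succ. now apply (proj1 (HS _)).
  - induction m as [|m IH].
    + apply (proj2 (HS _)). exact H0.
    + apply (proj2 (HS _)). now replace (- Z.of_nat (S (S m)) + 1)%Z with (- Z.of_nat (S m))%Z by lia.
Qed.

Lemma Cpow_neq0 z n : z <> C0 -> Cpow z n <> C0.
Proof.
  intro H. induction n; simpl; [apply (F_1_neq_0 Cplx_field_theory)|auto using Cmul_neq0].
Qed.
Lemma Czpow_nat z m : Czpow z (Z.of_nat m) = Cpow z m.
Proof. destruct m; [reflexivity|]. unfold Z.of_nat, Czpow. now rewrite SuccNat2Pos.id_succ. Qed.
Lemma Czpow_negnat z m : Czpow z (- Z.of_nat (S m)) = Cinv (Cpow z (S m)).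
Proof. unfold Z.of_nat, Z.opp, Czpow. now rewrite SuccNat2Pos.id_succ. Qed.
Lemma Czpow_neq0 z n : z <> C0 -> Czpow z n <> C0.
Proof.
  intro H. destruct n; simpl; auto using Cpow_neq0, Cinv_neq0. apply (F_1_neq_0 Cplx_field_theory).
Qed.
Lemma Czpow_succ z n : z <> C0 -> Czpow z (n + 1) = (Czpow z n * z)%X.
Proof.
  intro H. destruct (Z_sign_cases n) as [m [-> | ->]].
  - replace (Z.of_nat m + 1)%Z with (Z.of_nat (S m)) by lia. rewrite !Czpow_nat. simpl. ring.
  - destruct m as [|m].
    + simpl. field. auto.
    + replace (- Z.of_nat (S (S m)) + 1)%Z with (- Z.of_nat (S m))%Z by lia.
      rewrite !Czpow_negnat. simpl. field. auto using Cpow_neq0.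
Qed.
Lemma Czpow_add z n m : z <> C0 -> Czpow z (n + m) = (Czpow z n * Czpow z m)%X.
Proof.
  intro H. revert m. apply Z_step_ind.
  - rewrite Z.add_0_r. simpl. ring.
  - intro m. replace (n + (m + 1))%Z with (n + m + 1)%Z by ring. rewrite !Czpow_succ by auto.
    split; intro E; [rewrite E; ring|].
    replace (Czpow z (n + m)) with (Czpow z (n + m) * z / z)%X by (field; auto).
    rewrite E. field. auto.
Qed.
Lemma Czpow_opp z n : z <> C0 -> Czpow z (- n) = Cinv (Czpow z n).
Proof.
  intro H. pose proof (Czpow_neq0 z n H).
  replace (Czpow z (- n)) with (Czpow z (- n) * Czpow z n / Czpow z n)%X by (field; auto).
  rewrite <- Czpow_add by auto. replace (- n + n)%Z with 0%Z by ring. simpl. field. auto.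
Qed.
Lemma Czpow_mul_base z u n : z <> C0 -> u <> C0 -> Czpow (z * u) n = (Czpow z n * Czpow u n)%X.
Proof.
  intros Hz Hu. pose proof (Cmul_neq0 z u Hz Hu).
  revert n. apply Z_step_ind; [simpl; ring|].
  intro n. rewrite !Czpow_succ by auto. split; intro E; [rewrite E; ring|].
  replace (Czpow (z * u) n) with (Czpow (z * u) n * (z * u) / (z * u))%X by (field; auto).
  rewrite E. field. auto.
Qed.
Lemma Czpow_square_succ z n : z <> C0 ->
  Czpow z ((n + 1) * (n + 1)) = (Czpow z (n * n) * Czpow z n * Czpow z n * z)%X.
Proof.
  intro H. replace ((n + 1) * (n + 1))%Z with (n * n + n + n + 1)%Z by ring.
  now rewrite Czpow_succ, !Czpow_add by auto.
Qed.
(** The exponential form turns every later estimate of a product of powers into a comparison of real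
    exponents, linear or quadratic in the index. *)
Lemma Cnorm_Czpow z n : z <> C0 -> Cnorm (Czpow z n) = exp (ln (Cnorm z) * IZR n).
Proof.
  intro H. pose proof (Cnorm_gt0 z H) as Hp. revert n. apply Z_step_ind.
  - simpl. now rewrite Cnorm_1, Rmult_0_r, exp_0.
  - intro n. rewrite Czpow_succ, Cnorm_mul, plus_IZR, Rmult_plus_distr_l, exp_plus, Rmult_1_r, exp_ln by auto.
    split; intro E; [now rewrite E|]. apply Rmult_eq_reg_r in E; lra.
Qed.

(** * Bilateral sums *)

Lemma Csum_ext f g n : (forall k, f k = g k) -> Csum f n = Csum g n.
Proof. intro H. induction n; simpl; congruence. Qed.
Lemma Csum_add f g n : Csum (fun k => f k + g k)%X n = (Csum f n + Csum g n)%X.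
Proof. induction n as [|n IH]; simpl; [reflexivity|]. rewrite IH. ring. Qed.
Lemma Csum_scal c f n : Csum (fun k => c * f k)%X n = (c * Csum f n)%X.
Proof. induction n as [|n IH]; simpl; [reflexivity|]. rewrite IH. ring. Qed.
Lemma Csum_first f n : Csum f (S n) = (f O + Csum (fun k => f (S k)) n)%X.
Proof. induction n as [|n IH]; [reflexivity|]. simpl in *. rewrite IH. ring. Qed.

Lemma bicv_unique f l m : bicv f l -> bicv f m -> l = m.
Proof.
  intros [a [b [Ha [Hb ->]]]] [a' [b' [Ha' [Hb' ->]]]].
  now rewrite (Ccv_unique _ _ _ Ha Ha'), (Ccv_unique _ _ _ Hb Hb').
Qed.
Lemma bicv_ext f g l : (forall n, f n = g n) -> bicv f l -> bicv g l.
Proof.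
  intros H [a [b [Ha [Hb ->]]]]. exists a, b. repeat split.
  - eapply Ccv_ext; [|exact Ha]. intro. apply Csum_ext. auto.
  - eapply Ccv_ext; [|exact Hb]. intro. apply Csum_ext. auto.
Qed.
Lemma bicv_add f g l m : bicv f l -> bicv g m -> bicv (fun n => f n + g n)%X (l + m)%X.
Proof.
  intros [a [b [Ha [Hb ->]]]] [a' [b' [Ha' [Hb' ->]]]]. exists (a + a')%X, (b + b')%X. repeat split.
  - eapply Ccv_ext; [intro; symmetry; apply Csum_add|]. now apply Ccv_add.
  - eapply Ccv_ext; [intro; symmetry; apply Csum_add|]. now apply Ccv_add.
  - ring.
Qed.
Lemma bicv_scal c f l : bicv f l -> bicv (fun n => c * f n)%X (c * l)%X.
Proof.
  intros [a [b [Ha [Hb ->]]]]. exists (c * a)%X, (c * b)%X. repeat split.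
  - eapply Ccv_ext; [intro; symmetry; apply Csum_scal|]. now apply Ccv_scal.
  - eapply Ccv_ext; [intro; symmetry; apply Csum_scal|]. now apply Ccv_scal.
  - ring.
Qed.
Lemma bicv_sub f g l m : bicv f l -> bicv g m -> bicv (fun n => f n - g n)%X (l - m)%X.
Proof.
  intros Hf Hg. replace (l - m)%X with (l + - (1) * m)%X by ring.
  apply bicv_ext with (fun n => f n + - (1) * g n)%X; [intro; ring|].
  apply bicv_add; auto using bicv_scal.
Qed.
Lemma bicv_succ f l : bicv f l -> bicv (fun n => f (n + 1)%Z) l.
Proof.
  (* Under the shift the term at index 0 passes from the nonnegative half to the negative half. *)
  intros [a [b [Ha [Hb ->]]]]. exists (a - f 0%Z)%X, (b + f 0%Z)%X. repeat split.
  - apply Ccv_ext with (fun n => Csum (fun k => f (Z.of_nat k)) (n + 1)%nat - f 0%Z)%X.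
    { intro n. rewrite Nat.add_1_r, Csum_first.
      rewrite (Csum_ext (fun k => f (Z.of_nat k + 1)%Z) (fun k => f (Z.of_nat (S k)))).
      - simpl. ring.
      - intro. f_equal. lia. }
    apply Ccv_sub; [|apply Ccv_const]. exact (Ccv_shift _ _ 1 Ha).
  - apply Ccv_unshift.
    apply Ccv_ext with (fun n => Csum (fun k => f (- Z.of_nat (S k))%Z) n + f 0%Z)%X.
    { intro n. rewrite Csum_first.
      rewrite (Csum_ext (fun k => f (- Z.of_nat (S (S k)) + 1)%Z) (fun k => f (- Z.of_nat (S k))%Z)).
      - simpl. ring.
      - intro. f_equal. lia. }
    apply Ccv_add; auto using Ccv_const.
  - ring.
Qed.

Definition bsum (f : Z -> Cplx) : Cplx := epsilon (inhabits C0) (bicv f).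
Definition summable (f : Z -> Cplx) : Prop := exists l, bicv f l.

Lemma bicv_bsum f : summable f -> bicv f (bsum f).
Proof. apply epsilon_spec. Qed.
Lemma bsum_eq f l : bicv f l -> bsum f = l.
Proof. intro H. apply bicv_unique with f; [|exact H]. apply bicv_bsum. now exists l. Qed.

(** Any ratio below 1 would do, since Gaussian decay beats all of them. With 1/2 the tail of the
    geometric series beyond index M is exactly (1/2)^M, so no further constants appear. *)
Definition dominated (K : R) (f : Z -> Cplx) : Prop :=
  forall n, Cnorm (f n) <= K * (/ 2) ^ Z.abs_nat n.

Lemma Csum_geometric_tail f K M k : (forall n, Cnorm (f n) <= K * (/ 2) ^ n) ->
  Cnorm (Csum f (M + k) - Csum f M) <= K * ((/ 2) ^ M - (/ 2) ^ (M + k)).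
Proof.
  intro H. induction k as [|k IH].
  - rewrite Nat.add_0_r. replace (Csum f M - Csum f M)%X with C0 by ring. rewrite Cnorm_0. lra.
  - rewrite Nat.add_succ_r. simpl.
    replace (Csum f (M + k) + f (S (M + k)) - Csum f M)%X
      with ((Csum f (M + k) - Csum f M) + f (S (M + k)))%X by ring.
    eapply Rle_trans; [apply Cnorm_add|]. specialize (H (S (M + k))). simpl in H. lra.
Qed.
Lemma Csum_geometric_Ccv f K : (forall n, Cnorm (f n) <= K * (/ 2) ^ n) -> exists l, Ccv (Csum f) l.
Proof.
  intro H. apply geometric_increments_Ccv with K (/ 2); [lra|]. intro n.
  pose proof (Csum_geometric_tail f K n 1 H) as T. rewrite Nat.add_1_r in T.
  eapply Rle_trans; [exact T|].
  assert (0 <= K * (/ 2) ^ S n) by (eapply Rle_trans; [apply Cnorm_ge0|apply H]). lra.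
Qed.
Lemma Csum_geometric_limit f K l M : (forall n, Cnorm (f n) <= K * (/ 2) ^ n) ->
  Ccv (Csum f) l -> Cnorm (l - Csum f M) <= K * (/ 2) ^ M.
Proof.
  intros H Hl. apply Ccv_norm_le with (fun k => Csum f (k + M)%nat - Csum f M)%X.
  - intro k. rewrite Nat.add_comm. eapply Rle_trans; [apply Csum_geometric_tail; exact H|].
    assert (0 <= K * (/ 2) ^ (M + k)) by (eapply Rle_trans; [apply Cnorm_ge0|apply H]). lra.
  - apply Ccv_sub; [|apply Ccv_const]. now apply Ccv_shift.
Qed.
(** The tail beyond M is small uniformly in i by domination, and the first terms, finite in number,
    tend to 0. Limit 0 is enough: [bsum_tannery] applies this to the difference from the limiting
    family, on each half of the sum. *)
Lemma Csum_tannery (u : nat -> nat -> Cplx) K s :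
  (forall i n, Cnorm (u i n) <= K * (/ 2) ^ n) ->
  (forall n, Ccv (fun i => u i n) C0) -> (forall i, Ccv (Csum (u i)) (s i)) -> Ccv s C0.
Proof.
  intros HK H0 Hs e He.
  assert (K0 : 0 <= K).
  { specialize (HK O O). simpl in HK. pose proof (Cnorm_ge0 (u O O)). lra. }
  destruct (pow_lt_1_zero (/ 2) ltac:(rewrite Rabs_pos_eq; lra) (e / 2 / (K + 1))) as [M HM].
  { apply Rdiv_lt_0_compat; lra. }
  specialize (HM M (le_n _)). rewrite Rabs_pos_eq in HM by (apply pow_le; lra).
  assert (HM' : K * (/ 2) ^ M < e / 2).
  { apply Rle_lt_trans with (K * (e / 2 / (K + 1))).
    - apply Rmult_le_compat_l; lra.
    - apply Rlt_le_trans with ((K + 1) * (e / 2 / (K + 1))).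
      + apply Rmult_lt_compat_r; [apply Rdiv_lt_0_compat; lra|lra].
      + right. field. lra. }
  assert (HF : Ccv (fun i => Csum (u i) M) C0).
  { induction M as [|M IH] in |- *; simpl; [apply H0|].
    replace C0 with (0 + 0)%X by ring. apply Ccv_add; auto. }
  destruct (HF (e / 2)) as [N HN]; [lra|]. exists N. intros i Hi. specialize (HN i Hi).
  pose proof (Csum_geometric_limit (u i) K (s i) M (HK i) (Hs i)) as T.
  replace (s i - 0)%X with ((s i - Csum (u i) M) + (Csum (u i) M - 0))%X by ring.
  eapply Rle_lt_trans; [apply Cnorm_add|]. lra.
Qed.

Lemma dominated_nonneg K f : dominated K f -> forall n, Cnorm (f (Z.of_nat n)) <= K * (/ 2) ^ n.
Proof. intros H n. specialize (H (Z.of_nat n)). now rewrite Zabs2Nat.id in H. Qed.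
Lemma dominated_neg K f : dominated K f -> forall n, Cnorm (f (- Z.of_nat (S n))%Z) <= K * (/ 2) ^ n.
Proof.
  intros H n. specialize (H (- Z.of_nat (S n))%Z).
  replace (Z.abs_nat (- Z.of_nat (S n))) with (S n) in H by lia.
  pose proof (Cnorm_ge0 (f (- Z.of_nat (S n))%Z)). simpl pow in *. lra.
Qed.
Lemma dominated_summable K f : dominated K f -> summable f.
Proof.
  intro H.
  destruct (Csum_geometric_Ccv _ _ (dominated_nonneg _ _ H)) as [a Ha].
  destruct (Csum_geometric_Ccv _ _ (dominated_neg _ _ H)) as [b Hb].
  now exists (a + b)%X, a, b.
Qed.
Lemma bsum_tannery (g : nat -> Z -> Cplx) (f : Z -> Cplx) K :
  (forall i, dominated K (g i)) -> (forall n, Ccv (fun i => g i n) (f n)) ->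
  Ccv (fun i => bsum (g i)) (bsum f).
Proof.
  intros Hg Hf.
  assert (Df : dominated K f).
  { intro n. apply Ccv_norm_le with (fun i => g i n); auto. intro i. apply Hg. }
  set (u := fun i n => (g i n - f n)%X).
  assert (Du : forall i, dominated (2 * K) (u i)).
  { intros i n. unfold u. eapply Rle_trans; [apply Cnorm_sub|].
    specialize (Hg i n). specialize (Df n). lra. }
  assert (Hu : forall n, Ccv (fun i => u i n) C0).
  { intro n. replace C0 with (f n - f n)%X by ring. apply Ccv_sub; auto using Ccv_const. }
  set (a := fun i => Clim (Csum (fun n => u i (Z.of_nat n)))).
  set (b := fun i => Clim (Csum (fun n => u i (- Z.of_nat (S n))%Z))).
  assert (Ha : forall i, Ccv (Csum (fun n => u i (Z.of_nat n))) (a i)).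
  { intro i. destruct (Csum_geometric_Ccv _ _ (dominated_nonneg _ _ (Du i))) as [l Hl].
    exact (Ccv_Clim _ _ Hl). }
  assert (Hb : forall i, Ccv (Csum (fun n => u i (- Z.of_nat (S n))%Z)) (b i)).
  { intro i. destruct (Csum_geometric_Ccv _ _ (dominated_neg _ _ (Du i))) as [l Hl].
    exact (Ccv_Clim _ _ Hl). }
  apply Ccv_ext with (fun i => (a i + b i) + bsum f)%X.
  { intro i. symmetry. apply bsum_eq.
    apply bicv_ext with (fun n => u i n + f n)%X; [intro; unfold u; ring|].
    apply bicv_add; [exists (a i), (b i); auto|].
    apply bicv_bsum. eapply dominated_summable; exact Df. }
  enough (H : Ccv (fun i => a i + b i + bsum f)%X (0 + 0 + bsum f)%X).
  { now replace (0 + 0 + bsum f)%X with (bsum f) in H by ring. }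
  apply Ccv_add; [apply Ccv_add|apply Ccv_const].
  - apply (Csum_tannery (fun i n => u i (Z.of_nat n)) (2 * K)); auto.
    intros i. apply dominated_nonneg, Du.
  - apply (Csum_tannery (fun i n => u i (- Z.of_nat (S n))%Z) (2 * K)); auto.
    intros i. apply dominated_neg, Du.
Qed.

(** * Gaussian bounds *)

Lemma exp_ge_self x : x <= exp x.
Proof. pose proof (exp_ineq1_le x). lra. Qed.
Lemma exp_le_mono x y : x <= y -> exp x <= exp y.
Proof. intros [H| ->]; [left; now apply exp_increasing|right; reflexivity]. Qed.

(* The index i of the family only serves to state bounds that are uniform in a limit. *)
Definition gaussian (c : R) (f : nat -> Z -> Cplx) : Prop :=
  exists C, 0 <= C /\ forall i n,
    Cnorm (f i n) <= exp (C * (1 + IZR (Z.abs n)) + c * (IZR (Z.abs n) * IZR (Z.abs n))).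

Lemma IZR_abs_ge0 n : 0 <= IZR (Z.abs n).
Proof. apply IZR_le. lia. Qed.

Lemma gaussian_dominated c f : c < 0 -> gaussian c f -> exists K, forall i, dominated K (f i).
Proof.
  intros Hc [C [HC Hf]].
  (* Completing the square: (C + 1) m + c m^2 is at most (C + 1)^2 / (4 (-c)). One unit of the
     linear term is kept back for exp(-m), which is at most (1/2)^m. *)
  exists (exp (C + (C + 1) * (C + 1) / (4 * - c))). intros i n. eapply Rle_trans; [apply Hf|].
  assert (E : forall m : nat, exp (- INR m) <= (/ 2) ^ m).
  { induction m as [|m IH]; [simpl; rewrite Ropp_0, exp_0; lra|].
    rewrite S_INR. replace (- (INR m + 1)) with (- (1) + - INR m) by ring.
    rewrite exp_plus. simpl pow. apply Rmult_le_compat; auto using Rlt_le, exp_pos.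
    rewrite exp_Ropp. apply Rinv_le_contravar; [lra|]. pose proof (exp_ineq1_le 1). lra. }
  specialize (E (Z.abs_nat n)).
  rewrite INR_IZR_INZ, Zabs2Nat.id_abs in E.
  set (m := IZR (Z.abs n)) in *.
  apply Rle_trans with (exp (C + (C + 1) * (C + 1) / (4 * - c)) * exp (- m)).
  - rewrite <- exp_plus. apply exp_le_mono.
    enough (0 <= (C + 1) * (C + 1) / (4 * - c) - (C + 1) * m - c * (m * m)) by lra.
    replace ((C + 1) * (C + 1) / (4 * - c) - (C + 1) * m - c * (m * m))
      with ((2 * c * m + (C + 1)) * (2 * c * m + (C + 1)) * / (4 * - c)) by (field; lra).
    apply Rle_mult_inv_pos; [|lra]. apply Rle_0_sqr.
  - apply Rmult_le_compat_l; [left; apply exp_pos|exact E].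
Qed.
Lemma gaussian_summable c f : c < 0 -> gaussian c (fun _ => f) -> summable f.
Proof.
  intros Hc Hf. destruct (gaussian_dominated _ _ Hc Hf) as [K HK].
  exact (dominated_summable _ _ (HK O)).
Qed.
Lemma gaussian_tannery c g f : c < 0 -> gaussian c g -> (forall n, Ccv (fun i => g i n) (f n)) ->
  Ccv (fun i => bsum (g i)) (bsum f).
Proof.
  intros Hc Hg Hf. destruct (gaussian_dominated _ _ Hc Hg) as [K HK].
  now apply bsum_tannery with K.
Qed.

Lemma gaussian_ext c f g : (forall i n, f i n = g i n) -> gaussian c f -> gaussian c g.
Proof. intros H [C [HC Hf]]. exists C. split; [exact HC|]. intros. rewrite <- H. apply Hf. Qed.
Lemma gaussian_bounded f B : (forall i n, Cnorm (f i n) <= B) -> gaussian 0 f.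
Proof.
  intro H. pose proof (Rle_trans _ _ _ (Cnorm_ge0 _) (H O 0%Z)) as HB. exists B. split; [exact HB|].
  intros i n. eapply Rle_trans; [apply H|]. eapply Rle_trans; [apply exp_ge_self|].
  apply exp_le_mono. pose proof (IZR_abs_ge0 n). nra.
Qed.
Lemma gaussian_const z : gaussian 0 (fun _ _ => z).
Proof. apply gaussian_bounded with (Cnorm z). intros; lra. Qed.
Lemma gaussian_mul c d f g : gaussian c f -> gaussian d g -> gaussian (c + d) (fun i n => f i n * g i n)%X.
Proof.
  intros [C [HC Hf]] [D [HD Hg]]. exists (C + D). split; [lra|]. intros i n. rewrite Cnorm_mul.
  eapply Rle_trans; [apply Rmult_le_compat; auto using Cnorm_ge0|].
  rewrite <- exp_plus. apply exp_le_mono. lra.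
Qed.
Lemma gaussian_sub c f g : gaussian c f -> gaussian c g -> gaussian c (fun i n => f i n - g i n)%X.
Proof.
  (* The additional 1 pays for adding two bounds: exp(1 + m) is at least 2. *)
  intros [C [HC Hf]] [D [HD Hg]]. exists (C + D + 1). split; [lra|]. intros i n.
  eapply Rle_trans; [apply Cnorm_sub|]. specialize (Hf i n). specialize (Hg i n).
  pose proof (IZR_abs_ge0 n) as Hm. set (m := IZR (Z.abs n)) in *.
  replace ((C + D + 1) * (1 + m) + c * (m * m)) with (1 + m + ((C + D) * (1 + m) + c * (m * m))) by ring.
  assert (Cnorm (f i n) <= exp ((C + D) * (1 + m) + c * (m * m))).
  { eapply Rle_trans; [exact Hf|]. apply exp_le_mono. nra. }
  assert (Cnorm (g i n) <= exp ((C + D) * (1 + m) + c * (m * m))).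
  { eapply Rle_trans; [exact Hg|]. apply exp_le_mono. nra. }
  rewrite exp_plus. pose proof (exp_ineq1_le (1 + m)).
  pose proof (exp_pos ((C + D) * (1 + m) + c * (m * m))). nra.
Qed.
Lemma gaussian_opp_index c f : gaussian c f -> gaussian c (fun i n => f i (- n)%Z).
Proof.
  intros [C [HC Hf]]. exists C. split; [exact HC|]. intros i n.
  specialize (Hf i (- n)%Z). now rewrite Z.abs_opp in Hf.
Qed.
Lemma gaussian_Czpow w : w <> C0 -> gaussian 0 (fun _ n => Czpow w n).
Proof.
  intro Hw. exists (Rabs (ln (Cnorm w))). split; [apply Rabs_pos|]. intros _ n.
  rewrite Cnorm_Czpow by auto. apply exp_le_mono.
  eapply Rle_trans; [apply Rle_abs|]. rewrite Rabs_mult, <- abs_IZR.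
  pose proof (IZR_abs_ge0 n). pose proof (Rabs_pos (ln (Cnorm w))). nra.
Qed.
Lemma gaussian_Czpow_square z : z <> C0 -> gaussian (ln (Cnorm z)) (fun _ n => Czpow z (n * n)).
Proof.
  intro Hz. exists 0. split; [lra|]. intros _ n. rewrite Cnorm_Czpow by auto.
  rewrite <- mult_IZR, Z.abs_square. apply exp_le_mono. lra.
Qed.

(** * Infinite products *)

Lemma qpoch_first a q n : qpoch a q (S n) = ((1 - a) * qpoch (a * q) q n)%X.
Proof.
  induction n as [|n IH]; [simpl; ring|].
  change (qpoch a q (S n) * (1 - a * Cpow q (S n)) =
          (1 - a) * (qpoch (a * q) q n * (1 - a * q * Cpow q n)))%X.
  rewrite IH. simpl. ring.
Qed.

Section InfiniteProducts.
Context (q : Cplx) (hq : Cnorm q < 1) (hq0 : q <> C0).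

(** Both bounds come from |1 - z| <= 1 + |z| <= exp|z| and the partial geometric sum of the |a q^j|.
    They are proved together because the step for the distance to 1 uses the bound on the
    product. *)
Lemma Cnorm_qpoch_bounds a n :
  Cnorm (qpoch a q n) <= exp (Cnorm a * (1 - Cnorm q ^ n) / (1 - Cnorm q)) /\
  Cnorm (qpoch a q n - 1) <= exp (Cnorm a * (1 - Cnorm q ^ n) / (1 - Cnorm q)) - 1.
Proof.
  induction n as [|n [IH1 IH2]].
  - simpl. replace (1 - 1)%X with C0 by ring. rewrite Cnorm_0, Cnorm_1.
    replace (Cnorm a * (1 - 1) / (1 - Cnorm q)) with 0 by (field; lra). rewrite exp_0. lra.
  - set (E := exp (Cnorm a * (1 - Cnorm q ^ n) / (1 - Cnorm q))) in *.
    assert (HE : exp (Cnorm a * (1 - Cnorm q ^ S n) / (1 - Cnorm q)) = E * exp (Cnorm a * Cnorm q ^ n)).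
    { unfold E. rewrite <- exp_plus. f_equal. simpl. field. lra. }
    rewrite HE. simpl qpoch.
    pose proof (exp_ineq1_le (Cnorm a * Cnorm q ^ n)) as He.
    assert (Hz : Cnorm (a * Cpow q n) = Cnorm a * Cnorm q ^ n) by now rewrite Cnorm_mul, Cnorm_pow.
    pose proof (Cnorm_ge0 (a * Cpow q n)) as Hz0.
    assert (E1 : 0 < E) by apply exp_pos. pose proof (Cnorm_ge0 (qpoch a q n)).
    split.
    + rewrite Cnorm_mul. pose proof (Cnorm_sub 1 (a * Cpow q n)) as T. rewrite Cnorm_1 in T.
      apply Rmult_le_compat; auto using Cnorm_ge0. lra.
    + replace (qpoch a q n * (1 - a * Cpow q n) - 1)%X
        with ((qpoch a q n - 1) - qpoch a q n * (a * Cpow q n))%X by ring.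
      eapply Rle_trans; [apply Cnorm_sub|]. rewrite (Cnorm_mul (qpoch a q n)), Hz.
      rewrite Hz in Hz0. set (z := Cnorm a * Cnorm q ^ n) in *.
      pose proof (Rmult_le_compat_r z _ _ Hz0 IH1).
      pose proof (Rmult_le_compat_l E _ _ (Rlt_le _ _ E1) He). lra.
Qed.
Lemma qpoch_exponent_le a n :
  exp (Cnorm a * (1 - Cnorm q ^ n) / (1 - Cnorm q)) <= exp (Cnorm a / (1 - Cnorm q)).
Proof.
  apply exp_le_mono. apply Rmult_le_compat_r; [left; apply Rinv_0_lt_compat; lra|].
  pose proof (Cnorm_ge0 a). pose proof (pow_le (Cnorm q) n (Cnorm_ge0 q)). nra.
Qed.
Lemma qpoch_Ccv a : Ccv (qpoch a q) (qpinf a q).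
Proof.
  destruct (geometric_increments_Ccv (qpoch a q) (exp (Cnorm a / (1 - Cnorm q)) * Cnorm a) (Cnorm q)) as [l Hl].
  - split; [apply Cnorm_ge0|exact hq].
  - intro n. simpl.
    replace (qpoch a q n * (1 - a * Cpow q n) - qpoch a q n)%X
      with (- (qpoch a q n * (a * Cpow q n)))%X by ring.
    rewrite Cnorm_opp, !Cnorm_mul, Cnorm_pow, <- Rmult_assoc.
    apply Rmult_le_compat_r; [apply pow_le, Cnorm_ge0|].
    apply Rmult_le_compat_r; [apply Cnorm_ge0|].
    eapply Rle_trans; [apply Cnorm_qpoch_bounds|apply qpoch_exponent_le].
  - exact (Ccv_Clim _ _ Hl).
Qed.
Lemma qpinf_first a : qpinf a q = ((1 - a) * qpinf (a * q) q)%X.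
Proof.
  apply Ccv_unique with (qpoch a q); [apply qpoch_Ccv|]. apply Ccv_unshift.
  eapply Ccv_ext; [intro n; symmetry; apply qpoch_first|]. apply Ccv_scal, qpoch_Ccv.
Qed.
Lemma Cnorm_qpinf a : Cnorm (qpinf a q) <= exp (Cnorm a / (1 - Cnorm q)).
Proof.
  apply Ccv_norm_le with (qpoch a q); [|apply qpoch_Ccv].
  intro n. eapply Rle_trans; [apply Cnorm_qpoch_bounds|apply qpoch_exponent_le].
Qed.
Lemma Cnorm_qpinf_sub1 a :
  Cnorm (qpinf a q - 1) <= Cnorm a / (1 - Cnorm q) * exp (Cnorm a / (1 - Cnorm q)).
Proof.
  set (t := Cnorm a / (1 - Cnorm q)).
  apply Rle_trans with (exp t - 1).
  - apply Ccv_norm_le with (fun n => qpoch a q n - 1)%X.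
    + intro n. destruct (Cnorm_qpoch_bounds a n) as [_ T]. pose proof (qpoch_exponent_le a n). fold t in H. lra.
    + apply Ccv_sub; [apply qpoch_Ccv|apply Ccv_const].
  (* Multiplying 1 - t <= exp(-t) by exp(t) gives exp(t) - 1 <= t exp(t), a bound linear in a for
     small a. *)
  - pose proof (exp_ineq1_le (- t)) as T. rewrite exp_Ropp in T. pose proof (exp_pos t) as P.
    apply (Rmult_le_compat_l (exp t)) in T; [|lra]. rewrite Rinv_r in T by lra. lra.
Qed.
Lemma qpinf_limit x : Ccv (fun n => qpinf (x * Cpow q n) q) C1.
Proof.
  assert (D : 0 < / (1 - Cnorm q)) by (apply Rinv_0_lt_compat; lra).
  apply Ccv_geometric with (Cnorm x / (1 - Cnorm q) * exp (Cnorm x / (1 - Cnorm q))) (Cnorm q).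
  - split; [apply Cnorm_ge0|exact hq].
  - intro n. eapply Rle_trans; [apply Cnorm_qpinf_sub1|]. rewrite Cnorm_mul, Cnorm_pow.
    pose proof (Cnorm_ge0 x) as Hx. pose proof (pow_le (Cnorm q) n (Cnorm_ge0 q)) as Hp0.
    assert (Hp1 : Cnorm q ^ n <= 1) by (rewrite <- (pow1 n); apply pow_incr; pose proof (Cnorm_ge0 q); lra).
    replace (Cnorm x / (1 - Cnorm q) * exp (Cnorm x / (1 - Cnorm q)) * Cnorm q ^ n)
      with (Cnorm x * Cnorm q ^ n / (1 - Cnorm q) * exp (Cnorm x / (1 - Cnorm q))) by (field; lra).
    apply Rmult_le_compat_l.
    + apply Rle_mult_inv_pos; [|lra]. nra.
    + apply exp_le_mono. apply Rmult_le_compat_r; [lra|]. nra.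
Qed.
Lemma qpinf_qpoch a n : qpinf a q = (qpoch a q n * qpinf (a * Cpow q n) q)%X.
Proof.
  induction n as [|n IH].
  - simpl. replace (a * 1)%X with a by ring. ring.
  - rewrite IH, (qpinf_first (a * Cpow q n)). simpl.
    replace (a * Cpow q n * q)%X with (a * (q * Cpow q n))%X by ring. ring.
Qed.
(** Some tail (a q^N)_oo lies within distance 1 of 1, hence is not 0, and none of the N factors
    split off vanishes. *)
Lemma qpinf_neq0 a : (forall n, (a * Cpow q n)%X <> C1) -> qpinf a q <> C0.
Proof.
  intro H. destruct (qpinf_limit a 1) as [N HN]; [lra|]. specialize (HN N (le_n _)).
  rewrite (qpinf_qpoch a N). apply Cmul_neq0.
  - induction N as [|N IH] in |- *; simpl; [apply (F_1_neq_0 Cplx_field_theory)|].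
    apply Cmul_neq0; [exact IH|]. apply Csub_neq0. intro E. now apply (H N).
  - intro E. rewrite E in HN. replace (0 - 1)%X with (- (1))%X in HN by ring.
    rewrite Cnorm_opp, Cnorm_1 in HN. lra.
Qed.
Lemma qpinf_1 : qpinf 1 q = C0.
Proof. rewrite qpinf_first. ring. Qed.

(** For n >= 0 the product is bounded. For n = -m it has m additional factors 1 - x q^(-j), 1 <= j
    <= m, each of norm at most exp(X + L j) with L = -ln|q|. They contribute X m + L m (m + 1) / 2
    to the exponent, whence the quadratic coefficient L/2; the linear remainder goes into the
    constant. *)
Lemma gaussian_qpinf (x : nat -> Cplx) X : (forall i, Cnorm (x i) <= X) ->
  gaussian (- ln (Cnorm q) / 2) (fun i n => qpinf (x i * Czpow q n) q).
Proof.
  intro HX. pose proof (Rle_trans _ _ _ (Cnorm_ge0 _) (HX O)) as HX0.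
  pose proof (Cnorm_gt0 q hq0) as Hq.
  set (L := - ln (Cnorm q)).
  assert (HL : 0 < L). { unfold L. pose proof (ln_increasing (Cnorm q) 1 Hq hq). rewrite ln_1 in H. lra. }
  assert (D : 0 < / (1 - Cnorm q)) by (apply Rinv_0_lt_compat; lra).
  set (A := X / (1 - Cnorm q)).
  assert (HA : 0 <= A) by (apply Rle_mult_inv_pos; lra).
  assert (Hle : forall z, Cnorm z <= X -> Cnorm (qpinf z q) <= exp A).
  { intros z Hz. eapply Rle_trans; [apply Cnorm_qpinf|]. apply exp_le_mono.
    apply Rmult_le_compat_r; lra. }
  exists (A + X + L). split; [lra|]. intros i n.
  pose proof (Rle_0_sqr (IZR (Z.abs n))) as Hsq. unfold Rsqr in Hsq.
  pose proof (IZR_abs_ge0 n) as Habs.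
  destruct (Z_sign_cases n) as [m Hm].
  assert (Hm' : (exists m : nat, n = Z.of_nat m) \/ exists m : nat, n = (- Z.of_nat m)%Z)
    by (destruct Hm; [left|right]; eauto).
  clear m Hm. destruct Hm' as [[m Hm]|[m Hm]].
  - apply Rle_trans with (exp A).
    + apply Hle. rewrite Hm, Czpow_nat, Cnorm_mul, Cnorm_pow.
      pose proof (pow_le (Cnorm q) m (Cnorm_ge0 q)).
      assert (Cnorm q ^ m <= 1) by (rewrite <- (pow1 m); apply pow_incr; lra).
      pose proof (HX i). pose proof (Cnorm_ge0 (x i)). nra.
    + apply exp_le_mono. nra.
  - assert (H : Cnorm (qpinf (x i * Czpow q (- Z.of_nat m)) q)
                <= exp (A + X * INR m + L * (INR m * (INR m + 1) / 2))).
    { clear n Hm Hsq Habs. induction m as [|m IH].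
      - simpl. replace (A + X * 0 + L * (0 * (0 + 1) / 2)) with A by field.
        apply Hle. replace (x i * 1)%X with (x i) by ring. apply HX.
      - rewrite qpinf_first, Cnorm_mul.
        replace (x i * Czpow q (- Z.of_nat (S m)) * q)%X with (x i * Czpow q (- Z.of_nat m))%X.
        2:{ replace (- Z.of_nat m)%Z with (- Z.of_nat (S m) + 1)%Z by lia.
            rewrite Czpow_succ by auto. ring. }
        rewrite S_INR.
        replace (A + X * (INR m + 1) + L * ((INR m + 1) * (INR m + 1 + 1) / 2))
          with ((X + L * (INR m + 1)) + (A + X * INR m + L * (INR m * (INR m + 1) / 2))) by field.
        rewrite exp_plus. apply Rmult_le_compat; auto using Cnorm_ge0.
        eapply Rle_trans; [apply Cnorm_sub|]. rewrite Cnorm_1, Cnorm_mul, Cnorm_Czpow by auto.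
        rewrite opp_IZR, <- INR_IZR_INZ, S_INR.
        replace (ln (Cnorm q) * - (INR m + 1)) with (L * (INR m + 1)) by (unfold L; ring).
        rewrite exp_plus. pose proof (pos_INR m).
        assert (1 <= exp (L * (INR m + 1))) by (apply Rle_trans with (exp 0); [rewrite exp_0; lra|apply exp_le_mono, Rmult_le_pos; lra]).
        set (T := exp (L * (INR m + 1))) in *. assert (T0 : 0 <= T) by lra.
        pose proof (Rmult_le_compat_r T _ _ T0 (exp_ineq1_le X)).
        pose proof (Rmult_le_compat_r T _ _ T0 (HX i)). lra. }
    rewrite <- Hm in H. eapply Rle_trans; [exact H|]. apply exp_le_mono.
    replace (IZR (Z.abs n)) with (INR m) by (rewrite INR_IZR_INZ; f_equal; lia).
    pose proof (pos_INR m). unfold Rdiv. nra.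
Qed.
Lemma gaussian_qpinf_inv (x : nat -> Cplx) X : (forall i, Cnorm (x i) <= X) ->
  gaussian (- ln (Cnorm q) / 2) (fun i n => qpinf (x i / Czpow q n) q).
Proof.
  intro HX. eapply gaussian_ext; [|exact (gaussian_opp_index _ _ (gaussian_qpinf x X HX))].
  intros i n. simpl. now rewrite Czpow_opp.
Qed.
End InfiniteProducts.

(** * Uniqueness for q-difference equations *)

(** Iterating the inequality bounds x 0 by x n times a product of factors 1 + C r^k, which stays
    below exp(C / (1 - r)). Values of x that are arbitrarily small then force x 0 = 0. *)
Lemma gronwall_zero (x : nat -> R) C r : 0 <= r < 1 -> 0 <= C -> (forall n, 0 <= x n) ->
  (forall n, x n <= (1 + C * r ^ n) * x (S n)) ->
  (forall e, 0 < e -> exists N, x N < e) -> x O = 0.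
Proof.
  intros Hr HC Hx Hstep Hlim.
  assert (H : forall n, x O <= exp (C * (1 - r ^ n) / (1 - r)) * x n).
  { induction n as [|n IH].
    - simpl. replace (C * (1 - 1) / (1 - r)) with 0 by (field; lra). rewrite exp_0. lra.
    - replace (C * (1 - r ^ S n) / (1 - r)) with (C * (1 - r ^ n) / (1 - r) + C * r ^ n) by (simpl; field; lra).
      rewrite exp_plus, Rmult_assoc. eapply Rle_trans; [exact IH|].
      apply Rmult_le_compat_l; [left; apply exp_pos|]. eapply Rle_trans; [apply Hstep|].
      apply Rmult_le_compat_r; [apply Hx|]. apply exp_ineq1_le. }
  apply Rle_antisym; [|apply Hx]. apply le_epsilon. intros e He. rewrite Rplus_0_l.
  pose proof (exp_pos (C / (1 - r))) as P.
  destruct (Hlim (e / exp (C / (1 - r)))) as [N HN]; [now apply Rdiv_lt_0_compat|].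
  eapply Rle_trans; [apply (H N)|].
  apply Rle_trans with (exp (C / (1 - r)) * (e / exp (C / (1 - r)))).
  - apply Rmult_le_compat; auto using Rlt_le, exp_pos. apply exp_le_mono.
    apply Rmult_le_compat_r; [left; apply Rinv_0_lt_compat; lra|].
    pose proof (pow_le r N (proj1 Hr)). nra.
  - right. field. lra.
Qed.

Lemma Ccv0_max (u v : nat -> Cplx) : Ccv u C0 -> Ccv v C0 ->
  forall e, 0 < e -> exists N, Rmax (Cnorm (u N)) (Cnorm (v N)) < e.
Proof.
  intros Hu Hv e He. destruct (Hu e He) as [N HN]. destruct (Hv e He) as [M HM].
  exists (max N M). specialize (HN (max N M) ltac:(lia)). specialize (HM (max N M) ltac:(lia)).
  replace (u (max N M) - 0)%X with (u (max N M)) in HN by ring.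
  replace (v (max N M) - 0)%X with (v (max N M)) in HM by ring.
  now apply Rmax_lub_lt.
Qed.

(** The second equation contains u at index n, not n + 1, because this is what the shift relation
    delivers. Substituting the first equation brings everything to index n + 1, after which the
    larger of the two norms obeys a Gronwall inequality. *)
Lemma coupled_recurrence_zero (q c d : Cplx) (u v : nat -> Cplx) : Cnorm q < 1 ->
  (forall n, u n = (u (S n) + c * Cpow q n * v (S n))%X) ->
  (forall n, v n = (v (S n) + d * Cpow q n * u n)%X) ->
  Ccv u C0 -> Ccv v C0 -> u O = C0.
Proof.
  intros hq Hu Hv Lu Lv. apply Cnorm_eq0.
  pose proof (Cnorm_ge0 q). pose proof (Cnorm_ge0 c) as Hc. pose proof (Cnorm_ge0 d) as Hd.
  enough (H0 : Rmax (Cnorm (u O)) (Cnorm (v O)) = 0).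
  { apply Rle_antisym; [|apply Cnorm_ge0]. rewrite <- H0. apply Rmax_l. }
  (* The constant covers both equations: |c| for u, and |d| (1 + |c|) for v after the substitution,
     using |q|^n <= 1 once. *)
  apply (gronwall_zero (fun n => Rmax (Cnorm (u n)) (Cnorm (v n)))
    (Cnorm c + Cnorm d * (1 + Cnorm c)) (Cnorm q)); [lra|nra| | |].
  - intro n. eapply Rle_trans; [apply Cnorm_ge0|apply Rmax_l].
  - intro n.
    set (M := Rmax (Cnorm (u (S n))) (Cnorm (v (S n)))).
    assert (H1 : Cnorm (u (S n)) <= M) by apply Rmax_l.
    assert (H2 : Cnorm (v (S n)) <= M) by apply Rmax_r.
    assert (M0 : 0 <= M) by (eapply Rle_trans; [apply Cnorm_ge0|exact H1]).
    set (p := Cnorm q ^ n).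
    assert (P0 : 0 <= p) by (apply pow_le; lra).
    assert (P1 : p <= 1) by (unfold p; rewrite <- (pow1 n); apply pow_incr; lra).
    assert (Bu : Cnorm (u n) <= M + Cnorm c * p * M).
    { rewrite Hu. eapply Rle_trans; [apply Cnorm_add|]. rewrite !Cnorm_mul, Cnorm_pow. fold p.
      apply Rplus_le_compat; [exact H1|]. apply Rmult_le_compat_l; [nra|exact H2]. }
    assert (Bv : Cnorm (v n) <= M + Cnorm d * p * (M + Cnorm c * p * M)).
    { rewrite Hv. eapply Rle_trans; [apply Cnorm_add|]. rewrite !Cnorm_mul, Cnorm_pow. fold p.
      apply Rplus_le_compat; [exact H2|]. apply Rmult_le_compat_l; [nra|exact Bu]. }
    assert (0 <= p * M) by nra.
    assert (0 <= Cnorm c * (p * M)) by nra.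
    assert (0 <= Cnorm d * (p * M)) by nra.
    assert (0 <= Cnorm d * (Cnorm c * (p * M))) by nra.
    apply Rmax_lub.
    + nra.
    + eapply Rle_trans; [exact Bv|].
      replace (M + Cnorm d * p * (M + Cnorm c * p * M))
        with (M + Cnorm d * (p * M) + Cnorm d * (Cnorm c * (p * M)) * p) by ring. nra.
  - now apply Ccv0_max.
Qed.
(** A recurrence of order two becomes a Gronwall inequality for the maximum over two consecutive
    indices. *)
Lemma rogers_ramanujan_recurrence_zero (q c : Cplx) (u : nat -> Cplx) : Cnorm q < 1 ->
  (forall n, u n = (u (S n) + c * Cpow q n * u (S (S n)))%X) -> Ccv u C0 -> u O = C0.
Proof.
  intros hq Hu Lu. apply Cnorm_eq0.
  pose proof (Cnorm_ge0 q). pose proof (Cnorm_ge0 c) as Hc.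
  enough (H0 : Rmax (Cnorm (u 0%nat)) (Cnorm (u 1%nat)) = 0).
  { apply Rle_antisym; [|apply Cnorm_ge0]. rewrite <- H0. apply Rmax_l. }
  apply (gronwall_zero (fun n => Rmax (Cnorm (u n)) (Cnorm (u (S n)))) (Cnorm c) (Cnorm q)); [lra|lra| | |].
  - intro n. eapply Rle_trans; [apply Cnorm_ge0|apply Rmax_l].
  - intro n.
    set (M := Rmax (Cnorm (u (S n))) (Cnorm (u (S (S n))))).
    assert (H1 : Cnorm (u (S n)) <= M) by apply Rmax_l.
    assert (H2 : Cnorm (u (S (S n))) <= M) by apply Rmax_r.
    assert (M0 : 0 <= M) by (eapply Rle_trans; [apply Cnorm_ge0|exact H1]).
    set (p := Cnorm q ^ n).
    assert (P0 : 0 <= p) by (apply pow_le; lra).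
    assert (0 <= Cnorm c * p) by nra.
    apply Rmax_lub; [|nra].
    rewrite Hu. eapply Rle_trans; [apply Cnorm_add|]. rewrite !Cnorm_mul, Cnorm_pow. fold p. nra.
  - apply Ccv0_max; [exact Lu|]. apply Ccv_ext with (fun n => u (n + 1)%nat).
    + intro n. now rewrite Nat.add_1_r.
    + now apply Ccv_shift.
Qed.

(** * The three series *)

Section Series.
Context (q : Cplx) (hq : Cnorm q < 1) (hq0 : q <> C0).

(* Fsum, Hsum and Psum are the three sides of the theorem after clearing the infinite products
   by (y;q)_oo / (y;q)_r = (y q^r;q)_oo and its counterpart qpochZ_reflection. *)
Definition Fterm (w y : Cplx) (r : Z) : Cplx :=
  (Czpow w r * Czpow q (r * r) * qpinf (y * Czpow q r) q)%X.
Definition Hterm (w y : Cplx) (r : Z) : Cplx :=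
  (Czpow w r * Czpow q (r * r) * qpinf (y / w / Czpow q r) q)%X.
(** This is w^(3r) q^(3r^2 - r), spelled out as a product so that the Gaussian bounds multiply
    factor by factor and [ring] sees only [Czpow w r], [Czpow q (r * r)] and [Czpow q (- r)]. *)
Definition cubic_weight (w : Cplx) (r : Z) : Cplx :=
  (Czpow w r * Czpow w r * Czpow w r *
   (Czpow q (r * r) * Czpow q (r * r) * Czpow q (r * r)) * Czpow q (- r))%X.
Definition Pterm (w y : Cplx) (r : Z) : Cplx :=
  ((1 - w * (Czpow q r * Czpow q r)) * cubic_weight w r *
   (qpinf (y * Czpow q r) q * qpinf (y / w / Czpow q r) q))%X.
Definition Fsum w y := bsum (Fterm w y).
Definition Hsum w y := bsum (Hterm w y).
Definition Psum w y := bsum (Pterm w y).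
Definition theta (w : Cplx) : Cplx := (qpinf w q * qpinf (q / w) q)%X.

Lemma ln_q_neg : ln (Cnorm q) < 0.
Proof. rewrite <- ln_1. apply ln_increasing; auto using Cnorm_gt0. Qed.

Lemma gaussian_Fterm w y Y : w <> C0 -> (forall i, Cnorm (y i) <= Y) ->
  gaussian (0 + ln (Cnorm q) + - ln (Cnorm q) / 2) (fun i => Fterm w (y i)).
Proof.
  intros Hw HY. unfold Fterm.
  apply (gaussian_mul _ _ (fun _ r => Czpow w r * Czpow q (r * r))%X).
  - apply (gaussian_mul _ _ (fun _ r => Czpow w r) (fun _ r => Czpow q (r * r))).
    + now apply gaussian_Czpow.
    + now apply gaussian_Czpow_square.
  - exact (gaussian_qpinf q hq hq0 y Y HY).
Qed.
Lemma gaussian_Hterm w y Y : w <> C0 -> (forall i, Cnorm (y i / w) <= Y) ->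
  gaussian (0 + ln (Cnorm q) + - ln (Cnorm q) / 2) (fun i => Hterm w (y i)).
Proof.
  intros Hw HY. unfold Hterm.
  apply (gaussian_mul _ _ (fun _ r => Czpow w r * Czpow q (r * r))%X).
  - apply (gaussian_mul _ _ (fun _ r => Czpow w r) (fun _ r => Czpow q (r * r))).
    + now apply gaussian_Czpow.
    + now apply gaussian_Czpow_square.
  - exact (gaussian_qpinf_inv q hq hq0 (fun i => y i / w)%X Y HY).
Qed.
Lemma gaussian_cubic_weight w : w <> C0 ->
  gaussian (0 + 0 + 0 + (ln (Cnorm q) + ln (Cnorm q) + ln (Cnorm q)) + 0) (fun _ => cubic_weight w).
Proof.
  intro Hw. unfold cubic_weight.
  assert (G1 := gaussian_Czpow w Hw). assert (G2 := gaussian_Czpow_square q hq0).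
  assert (G3 := gaussian_opp_index _ _ (gaussian_Czpow q hq0)).
  exact (gaussian_mul _ _ _ _ (gaussian_mul _ _ _ _ (gaussian_mul _ _ _ _ (gaussian_mul _ _ _ _ G1 G1) G1)
    (gaussian_mul _ _ _ _ (gaussian_mul _ _ _ _ G2 G2) G2)) G3).
Qed.
(** The coefficient equals 2 ln|q|, left as an unevaluated sum to match [gaussian_mul]. The
    prefactor c is free because the bound serves the full [Pterm] as well as the two parts of 1 - w
    q^(2r) taken separately in [Psum_sub]. *)
Lemma gaussian_cubic w c x z X : w <> C0 -> gaussian 0 c ->
  (forall i, Cnorm (x i) <= X) -> (forall i, Cnorm (z i) <= X) ->
  gaussian (0 + (0 + 0 + 0 + (ln (Cnorm q) + ln (Cnorm q) + ln (Cnorm q)) + 0)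
    + (- ln (Cnorm q) / 2 + - ln (Cnorm q) / 2))
    (fun i r => c i r * cubic_weight w r *
      (qpinf (x i * Czpow q r) q * qpinf (z i / Czpow q r) q))%X.
Proof.
  intros Hw Hc Hx Hz.
  exact (gaussian_mul _ _ _ _ (gaussian_mul _ _ _ _ Hc (gaussian_cubic_weight w Hw))
    (gaussian_mul _ _ _ _ (gaussian_qpinf q hq hq0 x X Hx) (gaussian_qpinf_inv q hq hq0 z X Hz))).
Qed.
Lemma gaussian_square_monomial w : gaussian 0 (fun _ r => 1 - w * (Czpow q r * Czpow q r))%X.
Proof.
  assert (G := gaussian_Czpow q hq0).
  apply (gaussian_sub _ (fun _ _ => C1)); [apply gaussian_const|].
  pose proof (gaussian_mul _ _ _ _ (gaussian_const w) (gaussian_mul _ _ _ _ G G)) as T.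
  now rewrite !Rplus_0_l in T.
Qed.
Lemma gaussian_Pterm w y Y : w <> C0 -> (forall i, Cnorm (y i) <= Y) ->
  gaussian (0 + (0 + 0 + 0 + (ln (Cnorm q) + ln (Cnorm q) + ln (Cnorm q)) + 0)
    + (- ln (Cnorm q) / 2 + - ln (Cnorm q) / 2)) (fun i => Pterm w (y i)).
Proof.
  intros Hw HY.
  apply (gaussian_cubic w _ y (fun i => y i / w)%X (Y + Y / Cnorm w) Hw (gaussian_square_monomial w)).
  - intro i. pose proof (HY i). pose proof (Cnorm_ge0 (y i)). pose proof (Cnorm_gt0 w Hw).
    assert (0 <= Y / Cnorm w) by (apply Rle_mult_inv_pos; lra). lra.
  - intro i. unfold Cdiv. rewrite Cnorm_mul, Cnorm_inv by auto. pose proof (HY i).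
    pose proof (Cnorm_ge0 (y i)). pose proof (Cnorm_gt0 w Hw). unfold Rdiv.
    assert (0 < / Cnorm w) by now apply Rinv_0_lt_compat. nra.
Qed.

Lemma bicv_Fsum w y : w <> C0 -> bicv (Fterm w y) (Fsum w y).
Proof.
  intro Hw. apply bicv_bsum. pose proof ln_q_neg.
  eapply gaussian_summable; [|apply (gaussian_Fterm w (fun _ => y) (Cnorm y) Hw); intro; lra]. lra.
Qed.
Lemma bicv_Hsum w y : w <> C0 -> bicv (Hterm w y) (Hsum w y).
Proof.
  intro Hw. apply bicv_bsum. pose proof ln_q_neg.
  eapply gaussian_summable; [|apply (gaussian_Hterm w (fun _ => y) (Cnorm (y / w)) Hw); intro; lra]. lra.
Qed.
Lemma bicv_Psum w y : w <> C0 -> bicv (Pterm w y) (Psum w y).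
Proof.
  intro Hw. apply bicv_bsum. pose proof ln_q_neg.
  eapply gaussian_summable; [|apply (gaussian_Pterm w (fun _ => y) (Cnorm y) Hw); intro; lra]. lra.
Qed.

(** * The two relations for each of the three series *)

Lemma qpinf_div z : qpinf (z / q) q = ((1 - z / q) * qpinf z q)%X.
Proof. rewrite (qpinf_first q hq (z / q)). f_equal. f_equal. field. auto. Qed.

(** Termwise: (y q^r)_oo - (y q^(r+1))_oo = -y q^r (y q^(r+1))_oo, and the factor q^r turns w^r into
    (wq)^r. *)
Lemma Fsum_sub w y : w <> C0 -> (Fsum w y - Fsum w (q * y))%X = (- y * Fsum (w * q) (q * y))%X.
Proof.
  intro Hw. apply bicv_unique with (fun r => Fterm w y r - Fterm w (q * y) r)%X.
  - apply bicv_sub; now apply bicv_Fsum.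
  - eapply bicv_ext; [|apply bicv_scal, bicv_Fsum; auto using Cmul_neq0].
    intro r. unfold Fterm. rewrite Czpow_mul_base, (qpinf_first q hq (y * Czpow q r)) by auto.
    replace (y * Czpow q r * q)%X with (q * y * Czpow q r)%X by ring. ring.
Qed.
Lemma Fsum_shift w y : w <> C0 -> Fsum w y = (w * q * Fsum (w * q * q) (q * y))%X.
Proof.
  intro Hw. apply bicv_unique with (fun r => Fterm w y (r + 1)%Z).
  - now apply bicv_succ, bicv_Fsum.
  - eapply bicv_ext; [|apply bicv_scal, bicv_Fsum; auto using Cmul_neq0].
    intro r. unfold Fterm. rewrite Czpow_square_succ, !Czpow_succ, !Czpow_mul_base by auto using Cmul_neq0.
    replace (y * (Czpow q r * q))%X with (q * y * Czpow q r)%X by ring. ring.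
Qed.
(** The first factor of (y q^(-r)/w)_oo contributes q^(-r), the wrong direction for w -> wq. Taking
    the left side at r + 1 corrects this, since q^((r+1)^2) supplies q^(2r). *)
Lemma Hsum_sub w y : w <> C0 -> (Hsum w y - Hsum w (q * y))%X = (- y * Hsum (w * q) (q * y))%X.
Proof.
  intro Hw. apply bicv_unique with (fun r => Hterm w y (r + 1)%Z - Hterm w (q * y) (r + 1)%Z)%X.
  - apply bicv_sub; now apply bicv_succ, bicv_Hsum.
  - eapply bicv_ext; [|apply bicv_scal, bicv_Hsum; auto using Cmul_neq0].
    intro r. pose proof (Czpow_neq0 q r hq0).
    unfold Hterm. rewrite Czpow_square_succ, !Czpow_succ, !Czpow_mul_base by auto using Cmul_neq0.
    replace (y / w / (Czpow q r * q))%X with (y / w / Czpow q r / q)%X by (field; auto).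
    replace (q * y / w / (Czpow q r * q))%X with (y / w / Czpow q r)%X by (field; auto).
    replace (q * y / (w * q) / Czpow q r)%X with (y / w / Czpow q r)%X by (field; auto).
    rewrite qpinf_div. field. auto.
Qed.
Lemma Hsum_shift w y : w <> C0 -> Hsum w y = (w * q * Hsum (w * q * q) (q * y))%X.
Proof.
  intro Hw. apply bicv_unique with (fun r => Hterm w y (r + 1)%Z).
  - now apply bicv_succ, bicv_Hsum.
  - eapply bicv_ext; [|apply bicv_scal, bicv_Hsum; auto using Cmul_neq0].
    intro r. pose proof (Czpow_neq0 q r hq0).
    unfold Hterm. rewrite Czpow_square_succ, !Czpow_succ, !Czpow_mul_base by auto using Cmul_neq0.
    replace (q * y / (w * q * q) / Czpow q r)%X with (y / w / (Czpow q r * q))%X by (field; auto). ring.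
Qed.

Lemma cubic_weight_succ w r : w <> C0 ->
  cubic_weight w (r + 1) = (cubic_weight w r * (w * w * w) *
    (Czpow q r * Czpow q r * Czpow q r * Czpow q r * Czpow q r * Czpow q r) * (q * q))%X.
Proof.
  intro Hw. unfold cubic_weight. rewrite !Czpow_opp, Czpow_square_succ, !Czpow_succ by auto.
  field. auto using Czpow_neq0.
Qed.
Lemma cubic_weight_mul w r : w <> C0 ->
  cubic_weight (w * q) r = (cubic_weight w r * (Czpow q r * Czpow q r * Czpow q r))%X.
Proof.
  intro Hw. unfold cubic_weight. rewrite !Czpow_mul_base by auto. ring.
Qed.

(* Up to the two parts of the factor 1 - w q^(2r), of which the second is moved by one index,
   the difference of the two sides vanishes termwise. *)
Lemma Psum_sub w y : w <> C0 -> (Psum w y - Psum w (q * y))%X = (y * w * Psum (w * q) (q * y))%X.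
Proof.
  intro Hw. pose proof ln_q_neg.
  set (M := fun r => (Czpow q r * Czpow q r * Czpow q r * cubic_weight w r *
    (qpinf (q * y * Czpow q r) q * qpinf (y / w / Czpow q r) q))%X).
  set (N := fun r => (w * q * (Czpow q r * Czpow q r * Czpow q r * Czpow q r * Czpow q r) * cubic_weight w r *
    (qpinf (q * y * Czpow q r) q * qpinf (y / w / Czpow q r) q))%X).
  (* The two parts [M] and [N] of the right side are reindexed by different amounts, so each must
     converge on its own; convergence of their difference would not suffice. *)
  assert (S : forall c, gaussian 0 (fun _ => c) -> summable (fun r => c r * cubic_weight w r *
    (qpinf (q * y * Czpow q r) q * qpinf (y / w / Czpow q r) q))%X).
  { intros c Hc. eapply gaussian_summable; [|apply (gaussian_cubic w (fun _ => c) (fun _ => q * y)%X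
      (fun _ => y / w)%X (Cnorm (q * y) + Cnorm (y / w)) Hw Hc)].
    - lra.
    - intro. pose proof (Cnorm_ge0 (y / w)). lra.
    - intro. pose proof (Cnorm_ge0 (q * y)). lra. }
  assert (G := gaussian_Czpow q hq0).
  assert (GM : forall f g, gaussian 0 f -> gaussian 0 g -> gaussian 0 (fun i n => f i n * g i n)%X).
  { intros f g Hf Hg. pose proof (gaussian_mul _ _ _ _ Hf Hg) as T. now rewrite Rplus_0_l in T. }
  assert (SM : bicv M (bsum M)).
  { apply bicv_bsum. refine (S (fun r => Czpow q r * Czpow q r * Czpow q r)%X _).
    exact (GM _ _ (GM _ _ G G) G). }
  assert (SN : bicv N (bsum N)).
  { apply bicv_bsum.
    refine (S (fun r => w * q * (Czpow q r * Czpow q r * Czpow q r * Czpow q r * Czpow q r))%X _).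
    exact (GM _ _ (gaussian_const (w * q)) (GM _ _ (GM _ _ (GM _ _ (GM _ _ G G) G) G) G)). }
  assert (E1 : Psum (w * q) (q * y) = (bsum M - bsum N)%X).
  { apply bicv_unique with (Pterm (w * q) (q * y)); [apply bicv_Psum; auto using Cmul_neq0|].
    eapply bicv_ext; [|apply bicv_sub; [exact SM|exact SN]].
    intro r. unfold Pterm, M, N. rewrite cubic_weight_mul by auto.
    pose proof (Czpow_neq0 q r hq0).
    replace (q * y / (w * q) / Czpow q r)%X with (y / w / Czpow q r)%X by (field; auto). ring. }
  rewrite E1.
  apply bicv_unique with (fun r => Pterm w y (r + 1)%Z - Pterm w (q * y) (r + 1)%Z)%X.
  - apply bicv_sub; now apply bicv_succ, bicv_Psum.
  - eapply bicv_ext; [|apply bicv_scal, bicv_sub; [apply bicv_succ, SM|apply SN]].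
    intro r. pose proof (Czpow_neq0 q r hq0). unfold Pterm, M, N. simpl.
    rewrite cubic_weight_succ, !Czpow_succ by auto.
    replace (y / w / (Czpow q r * q))%X with (y / w / Czpow q r / q)%X by (field; auto).
    replace (q * y / w / (Czpow q r * q))%X with (y / w / Czpow q r)%X by (field; auto).
    replace (y * (Czpow q r * q))%X with (q * y * Czpow q r)%X by ring.
    rewrite (qpinf_first q hq (q * y * Czpow q r)), qpinf_div.
    replace (q * y * Czpow q r * q)%X with (q * y * (Czpow q r * q))%X by ring.
    field. auto.
Qed.
Lemma Psum_shift w y : w <> C0 -> Psum w y = (w * w * w * q * q * Psum (w * q * q) (q * y))%X.
Proof.
  intro Hw. apply bicv_unique with (fun r => Pterm w y (r + 1)%Z).
  - now apply bicv_succ, bicv_Psum.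
  - eapply bicv_ext; [|apply bicv_scal, bicv_Psum; auto using Cmul_neq0].
    intro r. pose proof (Czpow_neq0 q r hq0).
    unfold Pterm. rewrite cubic_weight_succ, !Czpow_succ, !cubic_weight_mul by auto using Cmul_neq0.
    replace (q * y / (w * q * q) / Czpow q r)%X with (y / w / (Czpow q r * q))%X by (field; auto).
    replace (y * (Czpow q r * q))%X with (q * y * Czpow q r)%X by ring. ring.
Qed.

Lemma theta_mul w : w <> C0 -> (w * theta (w * q))%X = (- theta w)%X.
Proof.
  intro Hw. unfold theta. rewrite (qpinf_first q hq w).
  replace (q / (w * q))%X with (q / w / q)%X by (field; auto). rewrite qpinf_div. field. auto.
Qed.
Lemma theta_neq0_mul w : w <> C0 -> theta w <> C0 -> theta (w * q) <> C0.
Proof.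
  intros Hw HT E. pose proof (theta_mul w Hw) as T. rewrite E in T. apply HT.
  replace (theta w) with (- - theta w)%X by ring. rewrite <- T. ring.
Qed.
Lemma theta_neq0_div w : w <> C0 -> theta w <> C0 -> theta (w / q) <> C0.
Proof.
  intros Hw HT E. pose proof (theta_mul (w / q) (Cdiv_neq0 _ _ Hw hq0)) as T. rewrite E in T.
  replace (w / q * q)%X with w in T by (field; auto).
  replace (- (0))%X with C0 in T by ring.
  destruct (Cmul_integral _ _ T) as [T'|T']; [|auto]. now apply (Cdiv_neq0 w q Hw hq0).
Qed.

(** By w theta(wq) = -theta(w), multiplying the relations of F by theta(w) yields exactly the
    relations of P, so the difference satisfies them too. *)
Definition defect w y := (theta w * Fsum w y - Psum w y)%X.

Lemma defect_sub w y : w <> C0 ->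
  (defect w y - defect w (q * y))%X = (y * w * defect (w * q) (q * y))%X.
Proof.
  intro Hw. unfold defect.
  replace (theta w * Fsum w y - Psum w y - (theta w * Fsum w (q * y) - Psum w (q * y)))%X
    with (theta w * (Fsum w y - Fsum w (q * y)) - (Psum w y - Psum w (q * y)))%X by ring.
  rewrite Fsum_sub, Psum_sub by auto.
  replace (theta w) with (- (w * theta (w * q)))%X by (rewrite theta_mul by auto; ring). ring.
Qed.
Lemma defect_shift w y : w <> C0 ->
  defect w y = (w * w * w * q * q * defect (w * q * q) (q * y))%X.
Proof.
  intro Hw. unfold defect. rewrite (Fsum_shift w y), (Psum_shift w y) by auto.
  replace (theta w) with (w * (w * q * theta (w * q * q)))%X; [ring|].
  rewrite theta_mul by auto using Cmul_neq0.
  replace (w * - theta (w * q))%X with (- (w * theta (w * q)))%X by ring.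
  rewrite theta_mul by auto. ring.
Qed.

(** * Limits along y q^N, and the equality of F and H *)

Lemma Cnorm_mul_Cpow_le x i : Cnorm (x * Cpow q i) <= Cnorm x.
Proof.
  rewrite Cnorm_mul, Cnorm_pow. pose proof (Cnorm_ge0 x). pose proof (Cnorm_ge0 q).
  assert (Cnorm q ^ i <= 1) by (rewrite <- (pow1 i); apply pow_incr; lra). nra.
Qed.
Lemma qpinf_limit_mul x c :
  Ccv (fun i => qpinf (x * Cpow q i * c) q) C1.
Proof.
  apply Ccv_ext with (fun i => qpinf (x * c * Cpow q i) q).
  - intro i. f_equal. ring.
  - now apply qpinf_limit.
Qed.

Lemma Fsum_limit w y : w <> C0 ->
  Ccv (fun i => Fsum w (y * Cpow q i)) (bsum (fun r => Czpow w r * Czpow q (r * r))%X).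
Proof.
  intro Hw. pose proof ln_q_neg.
  eapply gaussian_tannery; [|apply (gaussian_Fterm w _ (Cnorm y) Hw), Cnorm_mul_Cpow_le|]; [lra|].
  intro r. unfold Fterm.
  replace (Czpow w r * Czpow q (r * r))%X with (Czpow w r * Czpow q (r * r) * 1)%X at 1 by ring.
  apply Ccv_scal, qpinf_limit_mul.
Qed.
Lemma Hsum_limit w y : w <> C0 ->
  Ccv (fun i => Hsum w (y * Cpow q i)) (bsum (fun r => Czpow w r * Czpow q (r * r))%X).
Proof.
  intro Hw. pose proof ln_q_neg.
  eapply gaussian_tannery; [|apply (gaussian_Hterm w _ (Cnorm (y / w)) Hw)|]; [lra| |].
  - intro i. replace (y * Cpow q i / w)%X with (y / w * Cpow q i)%X by (field; auto).
    apply Cnorm_mul_Cpow_le.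
  - intro r. unfold Hterm.
    replace (Czpow w r * Czpow q (r * r))%X with (Czpow w r * Czpow q (r * r) * 1)%X at 1 by ring.
    apply Ccv_scal. apply Ccv_ext with (fun i => qpinf (y * Cpow q i * Cinv (w * Czpow q r)) q).
    + intro i. f_equal. field. auto using Czpow_neq0.
    + apply qpinf_limit_mul.
Qed.
Lemma Psum_limit w y : w <> C0 ->
  Ccv (fun i => Psum w (y * Cpow q i))
      (bsum (fun r => (1 - w * (Czpow q r * Czpow q r)) * cubic_weight w r)%X).
Proof.
  intro Hw. pose proof ln_q_neg.
  eapply gaussian_tannery; [|apply (gaussian_Pterm w _ (Cnorm y) Hw), Cnorm_mul_Cpow_le|]; [lra|].
  intro r. unfold Pterm.
  replace ((1 - w * (Czpow q r * Czpow q r)) * cubic_weight w r)%X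
    with ((1 - w * (Czpow q r * Czpow q r)) * cubic_weight w r * (1 * 1))%X at 1 by ring.
  apply Ccv_scal, Ccv_mul; [apply qpinf_limit_mul|].
  apply Ccv_ext with (fun i => qpinf (y * Cpow q i * Cinv (w * Czpow q r)) q).
  - intro i. f_equal. field. auto using Czpow_neq0.
  - apply qpinf_limit_mul.
Qed.

Theorem Fsum_eq_Hsum w y : w <> C0 -> Fsum w y = Hsum w y.
Proof.
  intro Hw. assert (Hwq : (w * q)%X <> C0) by now apply Cmul_neq0.
  assert (L : forall v, v <> C0 -> Ccv (fun i => Fsum v (y * Cpow q i) - Hsum v (y * Cpow q i))%X C0).
  { intros v Hv. set (l := bsum (fun r => Czpow v r * Czpow q (r * r))%X).
    replace C0 with (l - l)%X by ring. apply Ccv_sub; [now apply Fsum_limit|now apply Hsum_limit]. }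
  (* The first coefficient is that of the difference relation at w. The second is that of the
     relation at wq, where the shift relation replaces f(wq^2, qz) by f(w, z) / (wq). *)
  pose proof (coupled_recurrence_zero q (- y)%X (- y / (w * q))%X
    (fun i => Fsum w (y * Cpow q i) - Hsum w (y * Cpow q i))%X
    (fun i => Fsum (w * q) (y * Cpow q i) - Hsum (w * q) (y * Cpow q i))%X hq) as U.
  replace (Fsum w y) with (Fsum w y - Hsum w y + Hsum w y)%X by ring.
  enough (E : (Fsum w y - Hsum w y)%X = C0) by (rewrite E; ring).
  simpl in U. replace (y * 1)%X with y in U by ring.
  apply U; auto; clear U; intro n;
    replace (y * (q * Cpow q n))%X with (q * (y * Cpow q n))%X by ring;
    set (z := (y * Cpow q n)%X).
  - pose proof (Fsum_sub w z Hw) as EF. pose proof (Hsum_sub w z Hw) as EH.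
    replace (Fsum w z) with (Fsum w (q * z) + (Fsum w z - Fsum w (q * z)))%X by ring.
    replace (Hsum w z) with (Hsum w (q * z) + (Hsum w z - Hsum w (q * z)))%X by ring.
    rewrite EF, EH. unfold z. ring.
  - rewrite (Fsum_shift w z), (Hsum_shift w z) by auto.
    pose proof (Fsum_sub (w * q) z Hwq) as EF. pose proof (Hsum_sub (w * q) z Hwq) as EH.
    replace (Fsum (w * q) z) with (Fsum (w * q) (q * z) + (Fsum (w * q) z - Fsum (w * q) (q * z)))%X by ring.
    replace (Hsum (w * q) z) with (Hsum (w * q) (q * z) + (Hsum (w * q) z - Hsum (w * q) (q * z)))%X by ring.
    rewrite EF, EH. unfold z. field. auto.
Qed.

(** * The case y = q *)

Lemma Ccv_Cpow0 : Ccv (fun i => Cpow q i) C0.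
Proof.
  apply Ccv_geometric with 1 (Cnorm q); [split; [apply Cnorm_ge0|exact hq]|].
  intro n. replace (Cpow q n - 0)%X with (Cpow q n) by ring. rewrite Cnorm_pow. lra.
Qed.
Lemma qpinf_neg_power m : qpinf (Czpow q (- Z.of_nat m)) q = C0.
Proof.
  induction m as [|m IH]; [now apply qpinf_1|].
  rewrite qpinf_first, <- Czpow_succ by auto.
  replace (- Z.of_nat (S m) + 1)%Z with (- Z.of_nat m)%Z by lia. rewrite IH. ring.
Qed.
Lemma qpinf_mul_neg_power r : (r < 0)%Z -> qpinf (q * Czpow q r) q = C0.
Proof.
  intro Hr. replace (q * Czpow q r)%X with (Czpow q (- Z.of_nat (Z.to_nat (- r - 1)))).
  - apply qpinf_neg_power.
  - replace (- Z.of_nat (Z.to_nat (- r - 1)))%Z with (r + 1)%Z by lia. rewrite Czpow_succ by auto. ring.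
Qed.

(** This is q^(ir) cut off at negative r, where it would be unbounded in i. The cut-off is harmless
    at y = q, since (q q^r)_oo vanishes for r < 0. *)
Definition scale (i : nat) (r : Z) : Cplx :=
  if (r <? 0)%Z then C0 else Cpow (Cpow q i) (Z.to_nat r).

Lemma Cnorm_scale i r : Cnorm (scale i r) <= 1.
Proof.
  unfold scale. destruct (r <? 0)%Z; [rewrite Cnorm_0; lra|].
  rewrite !Cnorm_pow, <- (pow1 (Z.to_nat r)). pose proof (Cnorm_ge0 q).
  apply pow_incr. split; [now apply pow_le|]. rewrite <- (pow1 i). apply pow_incr. lra.
Qed.
Lemma Ccv_scale r : Ccv (fun i => scale i r) (if (r =? 0)%Z then C1 else C0).
Proof.
  unfold scale. destruct (Z.ltb_spec r 0).
  - replace (r =? 0)%Z with false by (symmetry; apply Z.eqb_neq; lia). apply Ccv_const.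
  - destruct (Z.eqb_spec r 0) as [->|Hr]; [exact (Ccv_const C1)|].
    destruct (Z.to_nat r) as [|m] eqn:E; [lia|].
    apply Ccv_ext with (fun i => Cpow (Cpow q i) m * Cpow q i)%X; [intro; simpl; ring|].
    apply Ccv0_mul_bounded with 1; [|apply Ccv_Cpow0]. intro i.
    rewrite !Cnorm_pow, <- (pow1 m). pose proof (Cnorm_ge0 q).
    apply pow_incr. split; [now apply pow_le|]. rewrite <- (pow1 i). apply pow_incr. lra.
Qed.
Lemma Czpow_mul_Cpow w i r : w <> C0 -> (0 <= r)%Z ->
  Czpow (w * Cpow q i) r = (Czpow w r * scale i r)%X.
Proof.
  intros Hw Hr. rewrite Czpow_mul_base by auto using Cpow_neq0. f_equal.
  unfold scale. replace (r <? 0)%Z with false by (symmetry; apply Z.ltb_ge; lia).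
  rewrite <- (Czpow_nat (Cpow q i)). f_equal. lia.
Qed.
Lemma gaussian_scale : gaussian 0 scale.
Proof. exact (gaussian_bounded _ 1 Cnorm_scale). Qed.

Lemma bsum_single z : bsum (fun r => if (r =? 0)%Z then z else C0) = z.
Proof.
  apply bsum_eq. exists z, C0. repeat split.
  - apply Ccv_ext with (fun _ => z); [|apply Ccv_const].
    induction n as [|n IH]; [reflexivity|]. cbn [Csum]. rewrite <- IH. simpl. ring.
  - apply Ccv_ext with (fun _ => C0); [|apply Ccv_const].
    induction n as [|n IH]; [reflexivity|]. cbn [Csum]. rewrite <- IH. simpl. ring.
  - ring.
Qed.
Lemma Fsum_scaling_limit w : w <> C0 -> Ccv (fun i => Fsum (w * Cpow q i) q) (qpinf q q).
Proof.
  intro Hw. pose proof ln_q_neg.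
  assert (E : forall i r, Fterm (w * Cpow q i) q r = (Fterm w q r * scale i r)%X).
  { intros i r. unfold Fterm. destruct (Z.lt_ge_cases r 0) as [Hr|Hr].
    - rewrite qpinf_mul_neg_power by auto. ring.
    - rewrite Czpow_mul_Cpow by auto. ring. }
  rewrite <- (bsum_single (qpinf q q)). unfold Fsum.
  pose proof (gaussian_mul _ _ _ _ (gaussian_Fterm w (fun _ => q) (Cnorm q) Hw (fun _ => Rle_refl _))
    gaussian_scale) as G.
  apply (gaussian_ext _ _ (fun i => Fterm (w * Cpow q i) q)) in G; [|intros i r; symmetry; apply E].
  eapply gaussian_tannery; [|exact G|]; [lra|].
  intro r. apply Ccv_ext with (fun i => Fterm w q r * scale i r)%X; [intro; now rewrite E|].
  replace (if (r =? 0)%Z then qpinf q q else C0) with (Fterm w q r * (if (r =? 0)%Z then C1 else C0))%X.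
  - apply Ccv_scal, Ccv_scale.
  - destruct (Z.eqb_spec r 0) as [->|_]; [|ring]. unfold Fterm. simpl.
    replace (q * 1)%X with q by ring. ring.
Qed.

(* (-1)^m q^(-m(m-1)/2), the factor that reverses a finite q-Pochhammer product *)
Fixpoint reversal (m : nat) : Cplx :=
  match m with O => C1 | S m => (- (reversal m / Cpow q m))%X end.

Lemma qpinf_reversal w m : w <> C0 ->
  (Cpow w m * qpinf (q / w / Cpow q m) q)%X = (reversal m * qpoch w q m * qpinf (q / w) q)%X.
Proof.
  intro Hw. induction m as [|m IH]; simpl.
  - replace (q / w / 1)%X with (q / w)%X; [ring|field; split; auto; apply (F_1_neq_0 Cplx_field_theory)].
  - pose proof (Cpow_neq0 q m hq0).
    replace (q / w / (q * Cpow q m))%X with (q / w / Cpow q m / q)%X by (field; auto).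
    rewrite qpinf_div.
    transitivity ((w - Cinv (Cpow q m)) * (Cpow w m * qpinf (q / w / Cpow q m) q))%X; [field; auto|].
    rewrite IH. field. auto.
Qed.
(** The true order is |q|^(-m(m-1)/2). The cruder |q|^(-m^2) makes the induction immediate and still
    leaves a negative total coefficient in [Psum_scaling_limit]. *)
Lemma gaussian_reversal : gaussian (- ln (Cnorm q)) (fun _ r => reversal (Z.abs_nat r)).
Proof.
  pose proof ln_q_neg as HL.
  assert (B : forall m, Cnorm (reversal m) <= exp (- ln (Cnorm q) * (INR m * INR m))).
  { induction m as [|m IH]; [simpl; rewrite Cnorm_1, !Rmult_0_r, exp_0; lra|].
    simpl reversal. unfold Cdiv. rewrite Cnorm_opp, Cnorm_mul, Cnorm_inv by auto using Cpow_neq0.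
    rewrite <- Czpow_nat, Cnorm_Czpow, <- INR_IZR_INZ, <- exp_Ropp by auto.
    eapply Rle_trans; [apply Rmult_le_compat_r; [left; apply exp_pos|exact IH]|].
    rewrite <- exp_plus. apply exp_le_mono. rewrite S_INR. pose proof (pos_INR m). nra. }
  exists 0. split; [lra|]. intros _ r. eapply Rle_trans; [apply B|]. apply exp_le_mono.
  replace (IZR (Z.abs r)) with (INR (Z.abs_nat r)) by (rewrite INR_IZR_INZ, Zabs2Nat.id_abs; reflexivity). lra.
Qed.
Lemma Ccv_qpoch_scaling x m : Ccv (fun i => qpoch (x * Cpow q i) q m) C1.
Proof.
  induction m as [|m IH]; simpl; [apply Ccv_const|].
  replace C1 with (1 * (1 - x * Cpow q m * 0))%X at 1 by ring.
  apply Ccv_mul; [exact IH|]. apply Ccv_sub; [apply Ccv_const|].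
  apply Ccv_ext with (fun i => x * Cpow q m * Cpow q i)%X; [intro; ring|].
  apply Ccv_scal, Ccv_Cpow0.
Qed.

(** With v = w q^i, the products (q^(1-r)/v)_oo are unbounded as i grows, which blocks a uniform
    bound. By [qpinf_reversal] each is a common factor (q/v)_oo times quantities bounded uniformly
    in i after multiplication by v^r. The common factor will cancel against theta(v). *)
Lemma Psum_scaling_limit w : w <> C0 -> exists S,
  (forall i, Psum (w * Cpow q i) q = (qpinf (q / (w * Cpow q i)) q * S i)%X) /\ Ccv S (qpinf q q).
Proof.
  intro Hw. pose proof ln_q_neg as HL.
  set (c := fun i r => (Czpow w r * Czpow w r * (Czpow q (r * r) * Czpow q (r * r) * Czpow q (r * r)) *
    Czpow q (- r) * reversal (Z.abs_nat r) * qpinf (q * Czpow q r) q *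
    ((1 - w * Cpow q i * (Czpow q r * Czpow q r)) * qpoch (w * Cpow q i) q (Z.abs_nat r)
      * (scale i r * scale i r)))%X).
  assert (E : forall i r, Pterm (w * Cpow q i) q r = (qpinf (q / (w * Cpow q i)) q * c i r)%X).
  { intros i r. pose proof (Cmul_neq0 _ _ Hw (Cpow_neq0 q i hq0)) as Hv.
    unfold Pterm, c. destruct (Z.lt_ge_cases r 0) as [Hr|Hr].
    - rewrite qpinf_mul_neg_power by auto. ring.
    - pose proof (qpinf_reversal (w * Cpow q i) (Z.abs_nat r) Hv) as T.
      rewrite <- (Czpow_nat (w * Cpow q i)), <- (Czpow_nat q (Z.abs_nat r)) in T. replace (Z.of_nat (Z.abs_nat r)) with r in T by lia.
      unfold cubic_weight. set (v := (w * Cpow q i)%X) in *.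
      (* One of the three powers v^r is spent on the reversal; the other two become the square of
         [scale] in [c]. *)
      transitivity ((1 - v * (Czpow q r * Czpow q r)) *
        (Czpow v r * Czpow v r * (Czpow q (r * r) * Czpow q (r * r) * Czpow q (r * r)) * Czpow q (- r)) *
        qpinf (q * Czpow q r) q * (Czpow v r * qpinf (q / v / Czpow q r) q))%X; [ring|].
      rewrite T. unfold v. rewrite Czpow_mul_Cpow by auto. ring. }
  assert (G : gaussian (0 + 0 + (ln (Cnorm q) + ln (Cnorm q) + ln (Cnorm q)) + 0 + - ln (Cnorm q)
      + - ln (Cnorm q) / 2 + (0 + 0 + (0 + 0))) c).
  { assert (G1 := gaussian_Czpow w Hw). assert (G2 := gaussian_Czpow_square q hq0).
    assert (G3 := gaussian_Czpow q hq0). assert (G4 := gaussian_opp_index _ _ G3).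
    assert (G5 := gaussian_qpinf q hq hq0 (fun _ => q) (Cnorm q) (fun _ => Rle_refl _)).
    assert (G6 : gaussian 0 (fun i r => 1 - w * Cpow q i * (Czpow q r * Czpow q r))%X).
    { apply (gaussian_sub _ (fun _ _ => C1)); [apply gaussian_const|].
      pose proof (gaussian_bounded (fun i (_ : Z) => w * Cpow q i)%X (Cnorm w)
        (fun i _ => Cnorm_mul_Cpow_le w i)) as G0.
      pose proof (gaussian_mul _ _ _ _ G0 (gaussian_mul _ _ _ _ G3 G3)) as T.
      now rewrite !Rplus_0_l in T. }
    assert (G7 : gaussian 0 (fun i r => qpoch (w * Cpow q i) q (Z.abs_nat r))).
    { apply gaussian_bounded with (exp (Cnorm w / (1 - Cnorm q))). intros i r.
      eapply Rle_trans; [apply Cnorm_qpoch_bounds; auto|].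
      eapply Rle_trans; [apply qpoch_exponent_le; auto|].
      apply exp_le_mono, Rmult_le_compat_r; [left; apply Rinv_0_lt_compat; lra|apply Cnorm_mul_Cpow_le]. }
    exact (gaussian_mul _ _ _ _ (gaussian_mul _ _ _ _ (gaussian_mul _ _ _ _ (gaussian_mul _ _ _ _
      (gaussian_mul _ _ _ _ (gaussian_mul _ _ _ _ G1 G1) (gaussian_mul _ _ _ _ (gaussian_mul _ _ _ _ G2 G2) G2))
      G4) gaussian_reversal) G5) (gaussian_mul _ _ _ _ (gaussian_mul _ _ _ _ G6 G7)
      (gaussian_mul _ _ _ _ gaussian_scale gaussian_scale))). }
  exists (fun i => bsum (c i)). split.
  - intro i. unfold Psum. apply bsum_eq.
    apply bicv_ext with (fun r => qpinf (q / (w * Cpow q i)) q * c i r)%X; [intro; now rewrite E|].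
    apply bicv_scal, bicv_bsum. destruct G as [C [HC HG]].
    eapply gaussian_summable; [|exists C; split; [exact HC|intros _; apply HG]]. lra.
  - rewrite <- (bsum_single (qpinf q q)).
    eapply gaussian_tannery; [|exact G|]; [lra|]. intro r.
    set (d := if (r =? 0)%Z then C1 else C0).
    replace (if (r =? 0)%Z then qpinf q q else C0)
      with (Czpow w r * Czpow w r * (Czpow q (r * r) * Czpow q (r * r) * Czpow q (r * r)) *
        Czpow q (- r) * reversal (Z.abs_nat r) * qpinf (q * Czpow q r) q * ((1 - 0) * 1 * (d * d)))%X.
    + unfold c. apply Ccv_scal, Ccv_mul; [apply Ccv_mul|apply Ccv_mul; apply Ccv_scale].
      * apply Ccv_sub; [apply Ccv_const|].
        replace C0 with (w * (Czpow q r * Czpow q r) * 0)%X by ring.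
        apply Ccv_ext with (fun i => w * (Czpow q r * Czpow q r) * Cpow q i)%X; [intro; ring|].
        apply Ccv_scal, Ccv_Cpow0.
      * apply Ccv_qpoch_scaling.
    + subst d. destruct (Z.eqb_spec r 0) as [->|_]; [|ring]. simpl.
      replace (q * 1)%X with q by ring. ring.
Qed.

Lemma theta_neq0_scaling w i : w <> C0 -> theta w <> C0 -> theta (w * Cpow q i) <> C0.
Proof.
  intros Hw HT. induction i as [|i IH]; simpl.
  - now replace (w * 1)%X with w by ring.
  - replace (w * (q * Cpow q i))%X with (w * Cpow q i * q)%X by ring.
    apply theta_neq0_mul; auto using Cmul_neq0, Cpow_neq0.
Qed.

(* At y = q the quotient by theta satisfies the recurrence u(w) = u(wq) + wq u(wq^2) of the
   Rogers-Ramanujan functions and tends to 0 with w. *)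
Lemma defect_q w : w <> C0 -> theta w <> C0 -> defect w q = C0.
Proof.
  intros Hw HT.
  assert (Hwi : forall i, (w * Cpow q i)%X <> C0) by (intro; auto using Cmul_neq0, Cpow_neq0).
  assert (HTi := fun i => theta_neq0_scaling w i Hw HT).
  pose proof (rogers_ramanujan_recurrence_zero q (w * q)%X
    (fun i => defect (w * Cpow q i) q / theta (w * Cpow q i))%X hq) as U.
  simpl in U. replace (w * 1)%X with w in U by ring.
  replace (defect w q) with (defect w q / theta w * theta w)%X by (field; auto).
  rewrite U; [ring| |].
  - clear U. intro n.
    replace (w * (q * Cpow q n))%X with (w * Cpow q n * q)%X by ring.
    replace (w * (q * (q * Cpow q n)))%X with (w * Cpow q n * q * q)%X by ring.
    specialize (Hwi n). specialize (HTi n).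
    replace (w * q * Cpow q n)%X with (w * Cpow q n * q)%X by ring.
    set (v := (w * Cpow q n)%X) in *.
    pose proof (theta_mul v Hwi) as T1.
    pose proof (theta_mul (v * q) (Cmul_neq0 _ _ Hwi hq0)) as T2.
    pose proof (theta_neq0_mul v Hwi HTi) as N1.
    pose proof (theta_neq0_mul (v * q) (Cmul_neq0 _ _ Hwi hq0) N1) as N2.
    (* Both relations at y = 1 have y = q on their right sides, so eliminating the value at y = 1
       leaves a recurrence in w alone. *)
    pose proof (defect_sub v 1 Hwi) as D1. pose proof (defect_shift v 1 Hwi) as D2.
    replace (q * 1)%X with q in D1, D2 by ring.
    replace (defect v q) with (defect v 1 - (defect v 1 - defect v q))%X by ring.
    rewrite D1, D2.
    assert (T3 : theta (v * q) = (- theta v / v)%X) by (rewrite <- T1; field; auto).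
    assert (T4 : theta (v * q * q) = (- theta (v * q) / (v * q))%X) by (rewrite <- T2; field; auto).
    rewrite T3 in T4. rewrite T3, T4. field. repeat split; auto using Copp_neq0.
  - destruct (Psum_scaling_limit w Hw) as [S [ES LS]].
    (* Of theta(w q^i) only (w q^i)_oo survives the cancellation, and it tends to 1. Both terms
       therefore tend to (q)_oo. *)
    apply Ccv_ext with (fun i => Fsum (w * Cpow q i) q - S i * Cinv (qpinf (w * Cpow q i) q))%X.
    { intro i. unfold defect. rewrite ES. specialize (HTi i). unfold theta in *.
      assert (qpinf (w * Cpow q i) q <> C0) by (intro E; apply HTi; rewrite E; ring).
      assert (qpinf (q / (w * Cpow q i)) q <> C0) by (intro E; apply HTi; rewrite E; ring).
      field. auto. }
    assert (N1 : C1 <> C0) by apply (F_1_neq_0 Cplx_field_theory).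
    replace C0 with (qpinf q q - qpinf q q * Cinv 1)%X by (field; exact N1).
    apply Ccv_sub; [now apply Fsum_scaling_limit|]. apply Ccv_mul; [exact LS|].
    apply Ccv_inv; [exact N1|]. now apply qpinf_limit.
Qed.
(** The shift relation raises y to qy at the price of moving w to w q^2. The induction hypothesis is
    therefore used at w / q^2, where theta is nonzero as well. *)
Lemma defect_q_power w N : w <> C0 -> theta w <> C0 -> defect w (q * Cpow q N) = C0.
Proof.
  revert w. induction N as [|N IH]; intros w Hw HT; simpl.
  - replace (q * 1)%X with q by ring. now apply defect_q.
  - assert (Hw1 : (w / q)%X <> C0) by now apply Cdiv_neq0.
    assert (Hw2 : (w / q / q)%X <> C0) by now apply Cdiv_neq0.
    pose proof (defect_shift (w / q / q) (q * Cpow q N) Hw2) as D.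
    rewrite IH in D by auto using theta_neq0_div.
    replace (w / q / q * q * q)%X with w in D by (field; auto).
    symmetry in D. destruct (Cmul_integral _ _ D) as [D'|D']; [exfalso|exact D'].
    revert D'. repeat apply Cmul_neq0; auto using Cinv_neq0.
Qed.

Lemma defect_limit w y : w <> C0 -> theta w <> C0 -> Ccv (fun i => defect w (y * Cpow q i)) C0.
Proof.
  intros Hw HT.
  set (l := (theta w * bsum (fun r => Czpow w r * Czpow q (r * r))
    - bsum (fun r => (1 - w * (Czpow q r * Czpow q r)) * cubic_weight w r))%X).
  assert (L : forall z, Ccv (fun i => defect w (z * Cpow q i)) l).
  { intro z. apply Ccv_sub; [apply Ccv_scal; now apply Fsum_limit|now apply Psum_limit]. }
  replace C0 with l; [apply L|].
  apply Ccv_unique with (fun i => defect w (q * Cpow q i)); [apply L|].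
  apply Ccv_ext with (fun _ => C0); [|apply Ccv_const]. intro. symmetry. now apply defect_q_power.
Qed.

Theorem theta_mul_Fsum w y : w <> C0 -> theta w <> C0 -> (theta w * Fsum w y)%X = Psum w y.
Proof.
  intros Hw HT. assert (Hwq : (w * q)%X <> C0) by now apply Cmul_neq0.
  (* The second coefficient is y w q, from the difference relation at wq, divided by w^3 q^2 from
     the shift relation. *)
  pose proof (coupled_recurrence_zero q (y * w)%X (y / (w * w * q))%X
    (fun i => defect w (y * Cpow q i)) (fun i => defect (w * q) (y * Cpow q i)) hq) as U.
  simpl in U. replace (y * 1)%X with y in U by ring.
  enough (E : defect w y = C0).
  { replace (theta w * Fsum w y)%X with (defect w y + Psum w y)%X by (unfold defect; ring).
    rewrite E. ring. }
  apply U; auto using defect_limit, theta_neq0_mul; clear U; intro n;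
    replace (y * (q * Cpow q n))%X with (q * (y * Cpow q n))%X by ring;
    set (z := (y * Cpow q n)%X).
  - replace (defect w z) with (defect w (q * z) + (defect w z - defect w (q * z)))%X by ring.
    rewrite defect_sub by auto. unfold z. ring.
  - rewrite (defect_shift w z) by auto.
    replace (defect (w * q) z) with (defect (w * q) (q * z) + (defect (w * q) z - defect (w * q) (q * z)))%X by ring.
    rewrite defect_sub by auto. unfold z. field. auto.
Qed.

(** * Quotients of infinite products *)

Lemma qpochZ_nat a m : qpochZ a q (Z.of_nat m) = qpoch a q m.
Proof. destruct m; [reflexivity|]. unfold qpochZ. now rewrite Nat2Z.id. Qed.
Lemma qpochZ_neg a m :
  qpochZ a q (- Z.of_nat (S m)) = Cinv (qpoch (a * Czpow q (- Z.of_nat (S m))) q (S m)).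
Proof. unfold Z.of_nat, Z.opp, qpochZ. now rewrite SuccNat2Pos.id_succ. Qed.
Lemma Czpow_neg_mul_Cpow m : (Czpow q (- Z.of_nat m) * Cpow q m)%X = C1.
Proof. rewrite Czpow_opp, Czpow_nat by auto. field. auto using Cpow_neq0. Qed.

Lemma qpinf_qpochZ a n : qpinf a q <> C0 -> (forall m : nat, a <> Cpow q (S m)) ->
  qpinf a q = (qpochZ a q n * qpinf (a * Czpow q n) q)%X.
Proof.
  intros Ha Hm. destruct (Z_sign_cases n) as [m [-> | ->]].
  - rewrite qpochZ_nat, Czpow_nat. now apply qpinf_qpoch.
  - rewrite qpochZ_neg, (qpinf_qpoch q hq (a * Czpow q (- Z.of_nat (S m))) (S m)).
    replace (a * Czpow q (- Z.of_nat (S m)) * Cpow q (S m))%X with a.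
    2:{ transitivity (a * (Czpow q (- Z.of_nat (S m)) * Cpow q (S m)))%X; [|ring].
        rewrite Czpow_neg_mul_Cpow. ring. }
    (* The number k of factors is separated from the shift j, so that the induction on k keeps the
       base a q^(-j) fixed. *)
    field. assert (K : forall k j, (k <= j)%nat -> qpoch (a * Czpow q (- Z.of_nat j)) q k <> C0).
    { intros k j. induction k as [|k IH]; intro Hk; simpl; [apply (F_1_neq_0 Cplx_field_theory)|].
      apply Cmul_neq0; [apply IH; lia|]. apply Csub_neq0. intro E.
      apply (Hm (j - S k)%nat). rewrite <- !Czpow_nat in *.
      replace (Z.of_nat (S (j - S k))) with (Z.of_nat j + - Z.of_nat k)%Z by lia.
      rewrite Czpow_add, Czpow_opp in * by auto.
      pose proof (Czpow_neq0 q (Z.of_nat j) hq0). pose proof (Czpow_neq0 q (Z.of_nat k) hq0).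
      transitivity (a * Cinv (Czpow q (Z.of_nat j)) * Czpow q (Z.of_nat k) *
        (Czpow q (Z.of_nat j) * Cinv (Czpow q (Z.of_nat k))))%X; [field; auto|].
      rewrite <- E. ring. }
    apply K. lia.
Qed.
Lemma qpochZ_succ_nonneg a n : (0 <= n)%Z ->
  qpochZ a q (n + 1) = (qpochZ a q n * (1 - a * Czpow q n))%X.
Proof.
  intro Hn. replace n with (Z.of_nat (Z.to_nat n)) by lia. set (m := Z.to_nat n).
  replace (Z.of_nat m + 1)%Z with (Z.of_nat (S m)) by lia.
  now rewrite !qpochZ_nat, Czpow_nat.
Qed.
Lemma qpochZ_pred_neg a n : (n < 0)%Z -> (a * Czpow q n)%X <> C1 ->
  qpochZ a q n = (qpochZ a q (n + 1) / (1 - a * Czpow q n))%X.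
Proof.
  intros Hn Ha. destruct (Z_sign_cases n) as [m [-> | ->]]; [lia|].
  assert (Ha' : (1 - a * Czpow q (- Z.of_nat (S m)))%X <> C0) by (apply Csub_neq0; auto).
  rewrite qpochZ_neg, qpoch_first.
  (* The convention [Cinv 0 = 0] covers u = 0, so only the factor being split off has to be
     nonzero. *)
  assert (Inv : forall z u, z <> C0 -> Cinv (z * u) = (Cinv u / z)%X).
  { intros z u Hz. destruct (excluded_middle_informative (u = C0)) as [-> | Hu]; [|field; auto].
    assert (Cinv 0 = C0) as E0 by (unfold Cinv, C0; simpl; f_equal; unfold Rdiv; ring).
    replace (z * 0)%X with C0 by ring. rewrite E0. field. auto. }
  rewrite Inv by auto. f_equal. destruct m as [|m].
  - simpl. field. apply (F_1_neq_0 Cplx_field_theory).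
  - replace (- Z.of_nat (S (S m)) + 1)%Z with (- Z.of_nat (S m))%Z by lia.
    rewrite qpochZ_neg. do 2 f_equal.
    replace (- Z.of_nat (S m))%Z with (- Z.of_nat (S (S m)) + 1)%Z by lia.
    rewrite Czpow_succ by auto. ring.
Qed.

Lemma triangular_succ n : ((n + 1) * (n + 1 - 1) / 2 = n * (n - 1) / 2 + n)%Z.
Proof. rewrite <- Z.div_add by lia. f_equal. ring. Qed.

(** Writing 1 - w q^j / y = (-w q^j / y) (1 - y q^(-j) / w) reverses the finite product: (y
    q^(-r)/w)_oo absorbs the second factors, and the monomials combine to w^r q^(r^2). *)
Lemma qpochZ_reflection w y r : w <> C0 -> y <> C0 ->
  (forall k : nat, w <> (y * Cpow q k)%X) ->
  (qpinf (y / w) q * (qpochZ (w * q / y) q r * Czpow (- y) r * Czpow q (r * (r - 1) / 2)))%X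
  = (Czpow w r * Czpow q (r * r) * qpinf (y / w / Czpow q r) q)%X.
Proof.
  intros Hw Hy Hk.
  assert (Hny : (- y)%X <> C0) by now apply Copp_neq0.
  (* The step is not an equivalence: upwards it multiplies by 1 - w q^(r+1) / y, which may vanish
     when r >= 0. Downwards it divides by this factor at r < 0, which the hypothesis on w and y
     keeps nonzero. *)
  revert r. apply Z.order_induction_0.
  - intros n m ->. reflexivity.
  - simpl. replace (y / w / 1)%X with (y / w)%X; [ring|].
    field. split; [exact Hw|apply (F_1_neq_0 Cplx_field_theory)].
  - intros r Hr IH. unfold Z.succ. pose proof (Czpow_neq0 q r hq0).
    rewrite qpochZ_succ_nonneg, triangular_succ, Czpow_square_succ, !Czpow_succ, Czpow_add by auto.
    replace (y / w / (Czpow q r * q))%X with (y / w / Czpow q r / q)%X by (field; auto).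
    rewrite qpinf_div.
    transitivity ((qpinf (y / w) q * (qpochZ (w * q / y) q r * Czpow (- y) r * Czpow q (r * (r - 1) / 2))) *
      ((w * q * Czpow q r - y) * Czpow q r))%X; [field; auto|].
    rewrite IH. field. auto.
  - intros r Hr IH. unfold Z.succ in IH. pose proof (Czpow_neq0 q r hq0) as Hqr.
    assert (Hne : (w * q / y * Czpow q r)%X <> C1).
    { intro E. apply (Hk (Z.to_nat (- r - 1))). rewrite <- Czpow_nat.
      replace (Z.of_nat (Z.to_nat (- r - 1))) with (- (r + 1))%Z by lia.
      rewrite Czpow_opp, Czpow_succ by auto.
      transitivity (y * (w * q / y * Czpow q r) / (Czpow q r * q))%X; [field; auto|].
      rewrite E. field. auto. }
    rewrite triangular_succ, Czpow_square_succ, !Czpow_succ, Czpow_add in IH by auto.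
    rewrite qpochZ_pred_neg by auto.
    replace (y / w / (Czpow q r * q))%X with (y / w / Czpow q r / q)%X in IH by (field; auto).
    rewrite qpinf_div in IH.
    set (a := Czpow q r) in *.
    assert (Hd : (w * q * a - y)%X <> C0).
    { intro E. apply Hne. transitivity ((w * q * a - y) / y + 1)%X; [field; auto|]. rewrite E. field. auto. }
    assert (Hd' : (y - w * q * a)%X <> C0).
    { replace (y - w * q * a)%X with (- (w * q * a - y))%X by ring. now apply Copp_neq0. }
    transitivity ((qpinf (y / w) q * (qpochZ (w * q / y) q (r + 1) * (Czpow (- y) r * - y) *
      (Czpow q (r * (r - 1) / 2) * a))) / ((w * q * a - y) * a))%X; [field; auto|].
    rewrite IH. field. auto.
Qed.
End Series.

Theorem mainTheorem7 (w y q : Cplx)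
  (hq : Cnorm q < 1) (hq0 : q <> C0)
  (hw0 : w <> C0) (hy0 : y <> C0)
  (hw : forall m : Z, w <> Czpow q m)
  (hy : forall m : Z, y <> Czpow q m)
  (hwy : forall k : nat, w <> Cmul y (Cpow q k)) :
  exists G : Cplx,
    bicv (G5term w y q) G /\
    (exists S1 : Cplx, bicv (rhs1term w y q) S1 /\
       G = Cmul (Cdiv (qpinf (Cdiv y w) q) (qpinf y q)) S1) /\
    (exists S2 : Cplx, bicv (rhs2term w y q) S2 /\
       G = Cmul (Cdiv (qpinf (Cdiv y w) q)
                      (Cmul (qpinf (Cmul w q) q) (qpinf (Cdiv q w) q))) S2).
Proof.
  assert (NP : forall z, (forall m, z <> Czpow q m) -> qpinf z q <> C0).
  { intros z Hz. apply qpinf_neq0; auto. intros n E. apply (Hz (- Z.of_nat n)%Z).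
    rewrite Czpow_opp, Czpow_nat by auto.
    pose proof (Cpow_neq0 q n hq0) as Hn.
    transitivity (z * Cpow q n / Cpow q n)%X; [field; exact Hn|]. rewrite E. field. exact Hn. }
  assert (Hy : qpinf y q <> C0) by auto.
  assert (Hyw : qpinf (y / w) q <> C0).
  { apply qpinf_neq0; auto. intros n E. apply (hwy n).
    transitivity (w * (y / w * Cpow q n))%X; [rewrite E; ring|field; auto]. }
  assert (H1w : (1 - w)%X <> C0) by (apply Csub_neq0, not_eq_sym; exact (hw 0%Z)).
  assert (Hw : qpinf w q <> C0) by auto.
  assert (Hwq : qpinf (w * q) q <> C0).
  { intro E. apply Hw. rewrite (qpinf_first q hq), E. ring. }
  assert (Hqw : qpinf (q / w) q <> C0).
  { apply qpinf_neq0; auto. intros n E. apply (hw (Z.of_nat (S n))). rewrite Czpow_nat.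
    transitivity (w * (q / w * Cpow q n))%X; [rewrite E; ring|simpl; field; auto]. }
  assert (Hqy : forall r, qpochZ y q r <> C0 /\
    (qpinf (y * Czpow q r) q = qpinf y q / qpochZ y q r)%X).
  { intro r.
    assert (E := qpinf_qpochZ q hq hq0 y r Hy (fun m E => hy (Z.of_nat (S m)) (eq_trans E (eq_sym (Czpow_nat q (S m)))))).
    assert (N : qpochZ y q r <> C0) by (intro E'; apply Hy; rewrite E, E'; ring).
    split; [exact N|]. rewrite E. field. exact N. }
  exists (Cinv (qpinf y q) * Fsum q w y)%X. split; [|split].
  - eapply bicv_ext; [|apply bicv_scal, (bicv_Fsum q hq hq0); exact hw0].
    intro r. destruct (Hqy r) as [N E]. unfold Fterm, G5term. rewrite E. field. auto.
  - exists (Cinv (qpinf (y / w) q) * Hsum q w y)%X. split.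
    + eapply bicv_ext; [|apply bicv_scal, (bicv_Hsum q hq hq0); exact hw0].
      intro r. unfold Hterm, rhs1term. rewrite <- (qpochZ_reflection q hq hq0) by auto. field. auto.
    + rewrite (Fsum_eq_Hsum q hq hq0) by auto. field. auto.
  - exists (Cinv (qpinf (y / w) q * qpinf y q * (1 - w)) * Psum q w y)%X. split.
    + eapply bicv_ext; [|apply bicv_scal, (bicv_Psum q hq hq0); exact hw0].
      intro r. destruct (Hqy r) as [N E]. pose proof (Czpow_neq0 q r hq0).
      assert (Hny : (- y)%X <> C0) by now apply Copp_neq0.
      unfold Pterm, rhs2term. rewrite E.
      replace (- (y * (w * w)))%X with (- y * w * w)%X by ring.
      (* The triangular part is what the reflection formula consumes; the rest comes from
         [cubic_weight] with one q^(r^2) removed. *)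
      replace ((5 * r * r - 3 * r) / 2)%Z with (r * (r - 1) / 2 + (r * r + r * r + - r))%Z.
      2:{ rewrite <- Z.div_add by lia. f_equal. ring. }
      replace (2 * r)%Z with (r + r)%Z by ring.
      rewrite !Czpow_add, !Czpow_mul_base by auto using Cmul_neq0.
      transitivity (Cinv (qpinf (y / w) q * (1 - w) * qpochZ y q r) * (1 - w * (Czpow q r * Czpow q r)) *
        (Czpow w r * Czpow w r * (Czpow q (r * r) * Czpow q (r * r)) * Czpow q (- r)) *
        (Czpow w r * Czpow q (r * r) * qpinf (y / w / Czpow q r) q))%X.
      * unfold cubic_weight. field. auto.
      * rewrite <- (qpochZ_reflection q hq hq0) by auto. field. auto.
    (* The product (w)_oo in theta is (1 - w)(wq)_oo; its first factor is the 1 - w standing in the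
       denominators of the terms. *)
    + assert (T := theta_mul_Fsum q hq hq0 w y hw0). unfold theta in T.
      rewrite <- T by (apply Cmul_neq0; auto). rewrite (qpinf_first q hq w). field. auto.
Qed.
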